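(* Let $N\ge 1$ be an integer and let $p,\theta>0$ satisfy $$\frac{1}{p+1}+\frac{1}{\theta+1}>\frac{N-2}{N}.$$ Then the system $$-\Delta u=v^p,\quad -\Delta v=u^\theta,\quad u,v>0\quad\text{in }\mathbb{R}^N$$ has no smooth stable solution $(u,v)$.
   Context: Stability (Montenegro): let $K\subset\mathbb{R}^N$ be a bounded regular domain. A smooth solution $(u,v)$ of $-\Delta u=v^p$, $-\Delta v=u^\theta$ is stable in $K$ if the eigenvalue problem $$-\Delta\xi=p\,v^{p-1}\zeta+\eta\,\xi,\qquad -\Delta\zeta=\theta\,u^{\theta-1}\xi+\eta\,\zeta\quad\text{in }K$$ has a nonnegative eigenvalue $\eta\ge 0$ with a pair $(\xi,\zeta)$ of positive smooth eigenfunctions. A smooth solution on $\mathbb{R}^N$ is called stable if it is stable in every bounded regular domain $K\subset\mathbb{R}^N$. *)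

(* Defs.v *)
From HB Require Import structures.
From mathcomp Require Import all_boot all_order all_algebra.
From mathcomp Require Import all_classical all_reals all_analysis.

Set Implicit Arguments.
Unset Strict Implicit.
Unset Printing Implicit Defensive.

Import Order.TTheory GRing.Theory Num.Theory.
Import numFieldNormedType.Exports.

Local Open Scope classical_set_scope.
Local Open Scope ring_scope.

Definition partial (R : realType) (N : nat) (i : 'I_N) (f : 'rV[R]_N -> R) :
    'rV[R]_N -> R :=
  fun x => 'D_(delta_mx 0 i) f x.

Definition iter_partial (R : realType) (N : nat) (s : seq 'I_N)
    (f : 'rV[R]_N -> R) : 'rV[R]_N -> R :=
  foldr (@partial R N) f s.

(* C^oo on an open set U: every iterated partial derivative exists and is
   continuous at each point of U. The values of f outside U are irrelevant. *)
Definition smooth_on (R : realType) (N : nat) (U : set 'rV[R]_N)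
    (f : 'rV[R]_N -> R) : Prop :=
  forall (s : seq 'I_N) (x : 'rV[R]_N), U x ->
    {for x, continuous (iter_partial s f)} /\
    forall i : 'I_N, derivable (iter_partial s f) x (delta_mx 0 i).

Definition laplacian (R : realType) (N : nat) (f : 'rV[R]_N -> R) :
    'rV[R]_N -> R :=
  fun x => \sum_(i < N) partial i (partial i f) x.

(* Near each boundary point, K is the sublevel set {phi < 0} of a smooth
   function phi with nonzero gradient there, i.e. K has a C^oo boundary and
   lies locally on one side of it. *)
Definition smooth_boundary (R : realType) (N : nat) (K : set 'rV[R]_N) : Prop :=
  forall x : 'rV[R]_N, (closure K `\` interior K) x ->
    exists (V : set 'rV[R]_N) (phi : 'rV[R]_N -> R),
      [/\ open V, V x, smooth_on V phi,
          exists i : 'I_N, partial i phi x != 0 &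
          forall y : 'rV[R]_N, V y -> (K y <-> phi y < 0)].

Definition bounded_regular_domain (R : realType) (N : nat)
    (K : set 'rV[R]_N) : Prop :=
  [/\ K !=set0, open K, connected K, bounded_set K & smooth_boundary K].

Definition Lane_Emden_solution (R : realType) (N : nat) (p theta : R)
    (u v : 'rV[R]_N -> R) : Prop :=
  [/\ smooth_on setT u, smooth_on setT v,
      forall x : 'rV[R]_N, 0 < u x /\ 0 < v x,
      forall x : 'rV[R]_N, - laplacian u x = v x `^ p &
      forall x : 'rV[R]_N, - laplacian v x = u x `^ theta].

(* No boundary condition is imposed on the eigenfunctions: only the equations
   in K, positivity and interior smoothness are required. *)
Definition stable_in (R : realType) (N : nat) (p theta : R)
    (u v : 'rV[R]_N -> R) (K : set 'rV[R]_N) : Prop :=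
  exists (eta : R) (xi zeta : 'rV[R]_N -> R),
    [/\ 0 <= eta,
        smooth_on K xi /\ smooth_on K zeta,
        forall x : 'rV[R]_N, K x -> 0 < xi x /\ 0 < zeta x,
        forall x : 'rV[R]_N, K x ->
          - laplacian xi x = p * v x `^ (p - 1) * zeta x + eta * xi x &
        forall x : 'rV[R]_N, K x ->
          - laplacian zeta x
            = theta * u x `^ (theta - 1) * xi x + eta * zeta x].

Definition stable (R : realType) (N : nat) (p theta : R)
    (u v : 'rV[R]_N -> R) : Prop :=
  forall K : set 'rV[R]_N,
    bounded_regular_domain K -> stable_in p theta u v K.

(* Main.v *)
(** Write [Lap] for the Laplacian; by symmetry assume [theta <= p].

    If [(p theta - 1) (N - 2) < 2 (p + 1)] there is no positive solution at all,
    stable or not: [u >= c |x|^(-s)] at infinity for a suitable positive [s >= N - 2],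
    because [u] is superharmonic, and comparison with [L - |x|^2] on balls turns the decay rate
    [s] of [u] into the rate [p (theta s - 2) - 2], which is strictly smaller, until
    the rate becomes negative.

    Otherwise [N >= 3] and [p theta > 1].  A Keller-Osserman argument gives
    [v^(p+1) / (p+1) <= u^(theta+1) / (theta+1)].  Let [S] be a power of
    [1 - |x|^2].  For [theta >= 2], testing the linearised system with [u^2 S / xi]
    and [u^2 S / zeta] yields a bound on the integral of [u v^p S] over the unit
    ball.  For [theta < 2], the tests [v^2 S / zeta] and [xi v^2 S / zeta^2] give
    the fourth-order form of stability, [p v^(p+1) S <= u^(theta+1) S / theta] up to
    lower order terms, and since [p theta > 1] and the integrals of [v^(p+1) S] and
    [u^(theta+1) S] agree up to lower order terms, both are bounded.  The bounds do
    not depend on the solution, so they hold for all the rescalings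
    [(m^alpha u(m x), m^beta v(m x))], whose energies grow like a power of [m] which
    exceeds [m^N] exactly in the subcritical range.

    No integration theory is needed: all estimates are pointwise inequalities
    modulo divergences of compactly supported [C^1] fields, and Riemann sums of
    such divergences tend to zero by telescoping. *)

Require Import Defs.
From mathcomp Require Import all_boot all_order all_algebra.
From mathcomp Require Import all_classical all_reals all_analysis.
From mathcomp Require Import ring lra.

Set Implicit Arguments.
Unset Strict Implicit.
Unset Printing Implicit Defensive.

Import Order.TTheory GRing.Theory Num.Theory.
Import numFieldNormedType.Exports.

Local Open Scope classical_set_scope.
Local Open Scope ring_scope.

(** * Differential calculus along the coordinate axes *)

Section Calculus.
Variables (R : realType) (N : nat).
Local Notation V := 'rV[R]_N.
Implicit Types (U : set V) (f g : V -> R) (df dg ddf ddg : 'I_N -> V -> R).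

(** The partial derivatives are explicit data; of the second derivatives only the
    pure ones [ddf i], that is d_i d_i f, are recorded. *)
Definition C1 U f df := (forall x, U x -> {for x, continuous f}) /\
  forall i x, U x -> {for x, continuous (df i)} /\
    is_derive x (delta_mx 0 i) f (df i x).

Definition C2 U f df ddf := C1 U f df /\ forall i x, U x ->
  {for x, continuous (ddf i)} /\
    is_derive x (delta_mx 0 i) (df i) (ddf i x).

Lemma C2_C1 U f df ddf : C2 U f df ddf -> C1 U f df.
Proof. by case. Qed.

Lemma C1_sub U U' f df : U' `<=` U -> C1 U f df -> C1 U' f df.
Proof.
by move=> sU [h1 h2]; split=> [x /sU /h1|i x /sU /h2].
Qed.

Lemma C2_sub U U' f df ddf : U' `<=` U -> C2 U f df ddf -> C2 U' f df ddf.
Proof. by move=> sU [h1 h2]; split; [exact: C1_sub h1|move=> i x /sU /h2]. Qed.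

(** Reduces directional derivatives to one real variable, where the chain rule and the mean value
    theorem are available. *)
Lemma is_derive_line f x v l :
  is_derive x v f l <-> is_derive (0 : R) 1 (fun h => f (h *: v + x)) l.
Proof.
have E : 'D_v f x = 'D_1 (fun h : R => f (h *: v + x)) 0.
  rewrite /derive; set g1 := fun h => h^-1 *: _; set g2 := fun h => h^-1 *: _.
  suff -> : g1 = g2 by [].
  rewrite funeqE /g1 /g2 => h /=.
  by rewrite addr0 scale0r add0r [_%:A]mulr1.
split=> -[d v0].
  by split; [exact: (derivable1P _ _ _).1|rewrite -E].
by split; [exact: (derivable1P _ _ _).2|rewrite E].
Qed.

Lemma is_derive_compR f (phi : R -> R) x v a b : is_derive x v f a ->
  is_derive (f x) 1 phi b -> is_derive x v (phi \o f) (b * a).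
Proof.
move=> /is_derive_line h1 h2; apply/is_derive_line.
apply: (@is_derive1_comp _ phi (fun h => f (h *: v + x))).
by rewrite scale0r add0r.
Qed.

Lemma C1_cst U c : C1 U (fun=> c) (fun _ _ => 0).
Proof.
split=> [x _|i x _]; first exact: cst_continuous.
by split; [exact: cst_continuous|exact: is_derive_cst].
Qed.

Lemma C2_cst U c : C2 U (fun=> c) (fun _ _ => 0) (fun _ _ => 0).
Proof.
split; first exact: C1_cst.
by move=> i x _; split; [exact: cst_continuous|exact: is_derive_cst].
Qed.

Lemma C1D U f g df dg : C1 U f df -> C1 U g dg ->
  C1 U (fun x => f x + g x) (fun i x => df i x + dg i x).
Proof.
move=> [cf hf] [cg hg]; split=> [x Ux|i x Ux].
  by apply: continuousD; [exact: cf|exact: cg].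
have [? ?] := hf i x Ux; have [? ?] := hg i x Ux; split.
  exact: continuousD.
exact: is_deriveD.
Qed.

Lemma C1M U f g df dg : C1 U f df -> C1 U g dg ->
  C1 U (fun x => f x * g x) (fun i x => df i x * g x + f x * dg i x).
Proof.
move=> [cf hf] [cg hg]; split=> [x Ux|i x Ux].
  by apply: continuousM; [exact: cf|exact: cg].
have [? ?] := hf i x Ux; have [? ?] := hg i x Ux; split.
  by apply: continuousD; apply: continuousM => //; [exact: cg|exact: cf].
apply: is_derive_eq; rewrite addrC; congr (_ + _).
by rewrite mulrC.
Qed.

Lemma C1_comp U f df (phi phi' : R -> R) : C1 U f df ->
  (forall x, U x -> is_derive (f x) 1 phi (phi' (f x))) ->
  (forall x, U x -> {for f x, continuous phi'}) ->
  C1 U (fun x => phi (f x)) (fun i x => phi' (f x) * df i x).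
Proof.
move=> [cf hf] hphi hphi'; split=> [x Ux|i x Ux].
  apply: continuous_comp; first exact: cf.
  apply: differentiable_continuous.
  by apply/derivable1_diffP; case: (hphi x Ux).
have cfx := cf x Ux; have [? ?] := hf i x Ux; split.
  by apply: continuousM => //; apply: continuous_comp => //; exact: hphi'.
apply: is_derive_compR; exact: hphi.
Qed.

Lemma C2D U f g df dg ddf ddg : C2 U f df ddf -> C2 U g dg ddg ->
  C2 U (fun x => f x + g x) (fun i x => df i x + dg i x)
    (fun i x => ddf i x + ddg i x).
Proof.
move=> [hf hf'] [hg hg']; split; first exact: C1D.
move=> i x Ux; have [? ?] := hf' i x Ux; have [? ?] := hg' i x Ux.
by split; [exact: continuousD|exact: is_deriveD].
Qed.

Lemma C2M U f g df dg ddf ddg : C2 U f df ddf -> C2 U g dg ddg ->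
  C2 U (fun x => f x * g x) (fun i x => df i x * g x + f x * dg i x)
    (fun i x => ddf i x * g x + 2 * (df i x * dg i x) + f x * ddg i x).
Proof.
move=> [hf hf'] [hg hg']; split; first exact: C1M.
move=> i x Ux; have [cddf d2f] := hf' i x Ux; have [cddg d2g] := hg' i x Ux.
have [cdf d1f] := hf.2 i x Ux; have [cdg d1g] := hg.2 i x Ux.
have cf := hf.1 x Ux; have cg := hg.1 x Ux.
split.
  apply: continuousD; last exact: continuousM.
  apply: continuousD; first exact: continuousM.
  by apply: continuousM; [exact: cst_continuous|exact: continuousM].
by apply: is_derive_eq; rewrite /GRing.scale/=; ring.
Qed.

Lemma C2_comp U f df ddf (phi phi' phi'' : R -> R) : C2 U f df ddf ->
  (forall x, U x -> is_derive (f x) 1 phi (phi' (f x))) ->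
  (forall x, U x -> is_derive (f x) 1 phi' (phi'' (f x))) ->
  (forall x, U x -> {for f x, continuous phi''}) ->
  C2 U (fun x => phi (f x)) (fun i x => phi' (f x) * df i x)
    (fun i x => phi'' (f x) * (df i x * df i x) + phi' (f x) * ddf i x).
Proof.
move=> [hf hf'] h1 h2 h3; split.
  apply: C1_comp => // x Ux; apply: differentiable_continuous.
  by apply/derivable1_diffP; case: (h2 x Ux).
move=> i x Ux; have [cddf d2f] := hf' i x Ux.
have cf := hf.1 x Ux; have [cdf d1f] := hf.2 i x Ux.
have cphi' : {for f x, continuous phi'}.
  by apply: differentiable_continuous; apply/derivable1_diffP; case: (h2 x Ux).
split.
  apply: continuousD; apply: continuousM => //.
  - by apply: continuous_comp => //; exact: h3.
  - exact: continuousM.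
  - exact: continuous_comp.
have d' : is_derive x (delta_mx 0 i) (phi' \o f) (phi'' (f x) * df i x).
  by apply: is_derive_compR; exact: h2.
by apply: is_derive_eq; rewrite /GRing.scale/=; ring.
Qed.

Lemma C1_eq U f df f' df' : C1 U f df -> f =1 f' ->
  (forall i, df i =1 df' i) -> C1 U f' df'.
Proof.
move=> h /funext <- E; have -> // : df' = df.
by apply/funext => i; apply/funext => x; rewrite E.
Qed.

Lemma C2_eq U f df ddf f' df' ddf' : C2 U f df ddf -> f =1 f' ->
  (forall i, df i =1 df' i) -> (forall i, ddf i =1 ddf' i) ->
  C2 U f' df' ddf'.
Proof.
move=> h /funext <- E E'; have -> : df' = df.
  by apply/funext => i; apply/funext => x; rewrite E.
have -> // : ddf' = ddf.
by apply/funext => i; apply/funext => x; rewrite E'.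
Qed.

Lemma C2Z U f df ddf c : C2 U f df ddf ->
  C2 U (fun x => c * f x) (fun i x => c * df i x) (fun i x => c * ddf i x).
Proof.
move=> h; apply: (C2_eq (C2M (C2_cst U c) h)) => // [i x|i x] /=; ring.
Qed.

Lemma C1Z U f df c : C1 U f df ->
  C1 U (fun x => c * f x) (fun i x => c * df i x).
Proof. by move=> h; refine (C1_eq (C1M (C1_cst U c) h) _ _) => // i x /=; ring. Qed.

Lemma C2B U f g df dg ddf ddg : C2 U f df ddf -> C2 U g dg ddg ->
  C2 U (fun x => f x - g x) (fun i x => df i x - dg i x)
    (fun i x => ddf i x - ddg i x).
Proof.
by move=> hf hg; apply: (C2_eq (C2D hf (C2Z (-1) hg))) => [x|i x|i x] /=;
  rewrite mulN1r.
Qed.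

(** The squared Euclidean norm; the norm on row vectors is the sup norm. *)
Definition nsq (x : V) := \sum_i x 0 i ^+ 2.

Lemma C2_coord U (j : 'I_N) : C2 U (fun x => x 0 j)
  (fun i _ => (i == j)%:R) (fun _ _ => 0).
Proof.
have D (i : 'I_N) (x : V) : is_derive x (delta_mx 0 i) (fun x => x 0 j) (i == j)%:R.
  apply/is_derive_line; rewrite (_ : (fun _ => _) =
    (fun h : R => h * (i == j)%:R + x 0 j)); last first.
    by apply/funext => h; rewrite !mxE eqxx /= eq_sym.
  by apply: is_derive_eq; rewrite /GRing.scale /=; ring.
split.
  split=> [x _|i x _]; first exact: coord_continuous.
  by split => //; exact: cst_continuous.
by move=> i x _; split; [exact: cst_continuous|exact: is_derive_cst].
Qed.

Lemma C2_sum U (I : Type) (r : seq I) (F : I -> V -> R) dF ddF :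
  (forall j, C2 U (F j) (dF j) (ddF j)) ->
  C2 U (fun x => \sum_(j <- r) F j x) (fun i x => \sum_(j <- r) dF j i x)
    (fun i x => \sum_(j <- r) ddF j i x).
Proof.
move=> h; elim: r => [|j r IH].
  by apply: (C2_eq (C2_cst U 0)) => [x|i x|i x] /=; rewrite big_nil.
by apply: (C2_eq (C2D (h j) IH)) => [x|i x|i x] /=; rewrite big_cons.
Qed.

Lemma C2_nsq U : C2 U nsq (fun i x => 2 * x 0 i) (fun _ _ => 2).
Proof.
apply: (C2_eq (C2_sum (index_enum 'I_N)
  (fun j => C2M (C2_coord U j) (C2_coord U j)))) => [x|i x|i x] /=.
- by apply: eq_bigr => j _; rewrite expr2.
- rewrite (bigD1 i)//= big1 ?eqxx ?mulr1n; first ring.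
  by move=> j /negbTE ji; rewrite eq_sym ji mulr0n; ring.
- rewrite (bigD1 i)//= big1 ?eqxx ?mulr1n; first ring.
  by move=> j /negbTE ji; rewrite eq_sym ji mulr0n; ring.
Qed.

End Calculus.

(** * Maximum principle *)

Section MaximumPrinciple.
Variables (R : realType) (N : nat).
Local Notation V := 'rV[R]_N.

Lemma is_derive1_shift (F : R -> R) (h l : R) :
  is_derive (0 : R) 1 (fun k => F (k + h)) l -> is_derive h 1 F l.
Proof.
have E : 'D_1 (fun k => F (k + h)) 0 = 'D_1 F h.
  rewrite /derive; set g1 := fun h => h^-1 *: _; set g2 := fun h => h^-1 *: _.
  suff -> : g1 = g2 by [].
  by rewrite funeqE /g1 /g2 => k /=; rewrite addr0 add0r.
move=> [d l0]; split; last by rewrite -E.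
move: d; rewrite /derivable.
set g1 := fun h => h^-1 *: _; set g2 := fun h => h^-1 *: _.
suff -> : g1 = g2 by [].
by rewrite funeqE /g1 /g2 => k /=; rewrite addr0 add0r.
Qed.

Lemma is_derive_line_at (f : V -> R) (x v : V) (h l : R) :
  is_derive (h *: v + x) v f l -> is_derive h 1 (fun k => f (k *: v + x)) l.
Proof.
move=> /is_derive_line H; apply: is_derive1_shift.
rewrite (_ : (fun _ => _) = (fun k => f (k *: v + (h *: v + x))))//.
by apply/funext => k; rewrite scalerDl addrA.
Qed.

(** If [F''] were positive, then [F'], which vanishes at 0, would be positive on an interval to the
    right of 0, and the mean value theorem would give [F h > F 0]. *)
Lemma second_derivative_max (F F' : R -> R) (F'' d : R) : 0 < d ->
  (forall h : R, `|h| < d -> is_derive h 1 F (F' h)) ->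
  is_derive (0 : R) 1 F' F'' ->
  (forall h : R, `|h| < d -> F h <= F 0) -> F' 0 = 0 /\ F'' <= 0.
Proof.
move=> d0 dF dF' mF.
have F'0 : F' 0 = 0.
  have d00 : (0 : R) \in `](- d), d[ by rewrite in_itv /= oppr_lt0 d0.
  have dd : - d <= d by rewrite ge0_cp// ltW.
  have H1 t : t \in `](- d), d[ -> derivable F t 1.
    by rewrite in_itv /= -ltr_norml => /dF [].
  have H2 t : t \in `](- d), d[ -> F t <= F 0.
    by rewrite in_itv /= -ltr_norml => /mF.
  have [_ E0] := derive1_at_max dd H1 d00 H2.
  have [_ E1] : is_derive (0 : R) 1 F (F' 0) by apply: dF; rewrite normr0.
  by rewrite -E1.
split => //; rewrite leNgt; apply/negP => F''0.
have [cv lv] := dF'.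
have := cv; rewrite /derivable; rewrite -/(derive F' 0 1).
move=> /cvgrPdist_lt /(_ F'' F''0); rewrite -/(derive F' 0 1) lv.
rewrite near_withinE => /nbhs_normP [e /= e0 He].
pose h := Num.min e d / 2.
have m0 : 0 < Num.min e d by rewrite lt_min e0.
have h0 : 0 < h by rewrite divr_gt0.
have hm : h < Num.min e d by rewrite ltr_pdivrMr// mulr_natr mulr2n ltrDl.
have he : h < e by rewrite (lt_le_trans hm)// ge_min lexx.
have hd : h < d by rewrite (lt_le_trans hm)// ge_min lexx orbT.
have F'pos c : 0 < c -> c < e -> 0 < F' c.
  move=> c0 ce; have := He c; rewrite /= sub0r normrN (gtr0_norm c0) => /(_ ce).
  rewrite gt_eqF// => /(_ isT); rewrite addr0 F'0 subr0 /GRing.scale /= mulr1.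
  move=> H; have : 0 < c^-1 * F' c.
    by move: H; rewrite ltr_norml => /andP[_]; rewrite gtrBl.
  by rewrite pmulr_rgt0// invr_gt0.
have [c|c|c] := @MVT R F F' 0 h h0.
- rewrite in_itv /= => /andP[c0 ch]; apply: dF.
  by rewrite gtr0_norm// (lt_trans ch).
- apply: derivable_within_continuous => t; rewrite in_itv /= => /andP[t0 th].
  by case: (dF t) => //; rewrite ger0_norm// (le_lt_trans th).
- rewrite in_itv /= => /andP[c0 ch].
  have := mF h; rewrite gtr0_norm// => /(_ hd); rewrite -subr_le0 => H E.
  move: H; rewrite E subr0 leNgt mulr_gt0// F'pos//.
  exact: lt_trans ch he.
Qed.

Lemma C2_at_max (U : set V) (f : V -> R) df ddf x : open U -> U x ->
  C2 U f df ddf -> (forall y, U y -> f y <= f x) ->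
  forall i, df i x = 0 /\ ddf i x <= 0.
Proof.
move=> oU Ux [[_ hf] hf'] mx i.
have /nbhs_normP [e /= e0 He] : nbhs x U by exact: open_nbhs_nbhs.
pose v : V := delta_mx 0 i.
have nv : 0 < `|v| + 1 by rewrite ltr_wpDl.
pose d := e / (`|v| + 1).
have d0 : 0 < d by rewrite divr_gt0.
have Uh h : `|h| < d -> U (h *: v + x).
  move=> hd; apply: He => /=; rewrite opprD addrCA subrr addr0 normrN normrZ.
  apply: (@le_lt_trans _ _ (`|h| * (`|v| + 1))).
    by rewrite ler_wpM2l// lerDl.
  by rewrite -ltr_pdivlMr.
have := @second_derivative_max (fun h => f (h *: v + x))
  (fun h => df i (h *: v + x)) (ddf i x) d d0.
rewrite scale0r add0r; apply.
- by move=> h /Uh /(hf i) [_ H]; exact: is_derive_line_at.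
- by apply: is_derive_line_at; rewrite scale0r add0r; case: (hf' i x Ux).
- by move=> h /Uh /mx.
Qed.

(** A positive maximum would be attained in [I], at a critical point with nonpositive pure second
    derivatives. Their sum has to be positive only where [f] is positive and critical, which lets
    [keller_osserman] eliminate the gradient. *)
Lemma maximum_principle (K I : set V) (f : V -> R) df ddf :
  compact K -> open I -> (forall x, K x -> {for x, continuous f}) ->
  C2 I f df ddf -> I `<=` K -> (forall x, K x -> ~ I x -> f x <= 0) ->
  (forall x, I x -> 0 < f x -> (forall i, df i x = 0) ->
     0 < \sum_i ddf i x) ->
  forall x, K x -> f x <= 0.
Proof.
move=> cK oI cf C IK bd H x Kx; rewrite leNgt; apply/negP => fx0.
have [||c Kc mc] := @EVT_max_rV R N f K _ cK.
- by exists x.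
- apply: continuous_in_subspaceT => y; rewrite inE => Ky; exact: cf.
rewrite inE in Kc.
have fc0 : 0 < f c by rewrite (lt_le_trans fx0)// mc// inE.
have Ic : I c by apply: contrapT => /(bd c Kc); rewrite leNgt fc0.
have E := @C2_at_max I f df ddf c oI Ic C _.
have {}E : forall i, df i c = 0 /\ ddf i c <= 0.
  by apply: E => y Iy; apply: mc; rewrite inE; exact: IK.
have := H c Ic fc0 (fun i => (E i).1).
by rewrite ltNge sumr_le0// => i _; case: (E i).
Qed.

End MaximumPrinciple.

(** * Divergences of compactly supported fields *)

Section NullIntegral.
Variables (R : realType) (N : nat).
Local Notation V := 'rV[R]_N.

(** [F] is, on the unit ball, the divergence of a [C^1] field [g] supported in the
    closed unit ball: the substitute for "[F] has integral zero". *)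
Definition nullint (F : V -> R) := exists (g D : 'I_N -> V -> R),
  [/\ forall i x, is_derive x (delta_mx 0 i) (g i) (D i x),
      forall i x, {for x, continuous (D i)},
      forall i x, 1 <= nsq x -> g i x = 0,
      forall i x, 1 <= nsq x -> D i x = 0 &
      forall x, nsq x < 1 -> F x = \sum_i D i x].

Lemma nullintD F G : nullint F -> nullint G -> nullint (fun x => F x + G x).
Proof.
move=> [g [D [h1 h2 h3 h4 h5]]] [g' [D' [h1' h2' h3' h4' h5']]].
exists (fun i x => g i x + g' i x), (fun i x => D i x + D' i x); split.
- by move=> i x; apply: is_deriveD.
- by move=> i x; apply: continuousD; [exact: h2|exact: h2'].
- by move=> i x x1; rewrite h3// h3'// addr0.
- by move=> i x x1; rewrite h4// h4'// addr0.
- by move=> x x1; rewrite h5// h5'// big_split.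
Qed.

Lemma nullintZ c F : nullint F -> nullint (fun x => c * F x).
Proof.
move=> [g [D [h1 h2 h3 h4 h5]]].
exists (fun i x => c * g i x), (fun i x => c * D i x); split.
- by move=> i x; apply: is_deriveZ.
- by move=> i x; apply: continuousM; [exact: cst_continuous|exact: h2].
- by move=> i x x1; rewrite h3// mulr0.
- by move=> i x x1; rewrite h4// mulr0.
- by move=> x x1; rewrite h5// mulr_sumr.
Qed.

Lemma uniform_continuity_compact (K : set V) (f : V -> R) (e : R) :
  compact K -> continuous f -> 0 < e -> exists2 d, 0 < d &
  forall x y, K x -> `|y - x| < d -> `|f y - f x| < e.
Proof.
move=> /compact_near_coveringP cK cf e0.
have nbV (x : V) r : 0 < r -> nbhs x [set y | `|x - y| < r].
  move=> r0; have [_ H] := @nbhs_normP R V x [set y | `|x - y| < r].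
  by apply: H; exists r.
have := cK R (0 : R)^'+ (fun d x => forall y, `|y - x| < d -> `|f y - f x| < e) _.
case.
- move=> x Kx.
  have e2 : 0 < e / 2 by rewrite divr_gt0.
  have /nbhs_normP [r /= r0 Hr] : nbhs x [set y | `|f x - f y| < e / 2].
    by have := cf x; move=> /cvgrPdist_lt /(_ _ e2).
  have r2 : 0 < r / 2 by rewrite divr_gt0.
  exists ([set y | `|x - y| < r / 2], [set d | d < r / 2]).
    split=> /=; first exact: nbV.
    exact: nbhs_right_lt.
  move=> [x' d] /= [xx' dr] y yx'.
  have H1 := Hr x' _; have H2 := Hr y _.
  have {H1} : `|f x - f x'| < e / 2.
    by apply: H1 => /=; rewrite (lt_le_trans xx')// ler_piMr// ?ltW// invf_lt1// ltr1n.
  have {H2} : `|f x - f y| < e / 2.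
    apply: H2 => /=; rewrite -(subrK x' x) -addrA (le_lt_trans (ler_normD _ _))//.
    rewrite [ltRHS]splitr ltrD// distrC; exact: lt_trans dr.
  move=> H2 H1; rewrite -(subrK (f x) (f y)) -addrA.
  rewrite (le_lt_trans (ler_normD _ _))// [ltRHS]splitr ltrD//.
  by rewrite distrC.
- move=> r /= r0 Hr; exists (r / 2); first by rewrite divr_gt0.
  move=> x y Kx; apply: Hr => //=; last by rewrite divr_gt0.
  by rewrite sub0r normrN gtr0_norm ?divr_gt0// ltr_pdivrMr// ltr_pMr// ltr1n.
Qed.

Lemma uniform_continuity_family (K : set V) (f : 'I_N -> V -> R) (e : R) :
  compact K -> (forall i, continuous (f i)) -> 0 < e -> exists2 d, 0 < d &
  forall i x y, K x -> `|y - x| < d -> `|f i y - f i x| < e.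
Proof.
move=> cK cf e0.
have H (i : 'I_N) : exists d, 0 < d /\
    forall x y, K x -> `|y - x| < d -> `|f i y - f i x| < e.
  by have [d d0 dP] := uniform_continuity_compact cK (cf i) e0; exists d.
have [d dP] := choice H.
exists (\big[Num.min/1]_i d i).
  elim/big_ind : _ => // [a b a0 b0|i _]; first by rewrite lt_min a0.
  by have [] := dP i.
move=> i x y Kx xy; have [_] := dP i; apply => //.
by apply: (lt_le_trans xy); exact: bigmin_le.
Qed.

Definition cube : set V := [set x | forall i, x ord0 i \in `[(-1), 1] ].

Lemma compact_cube : compact cube.
Proof.
apply: (@rV_compact _  _ (fun=> `[(-1 : R), 1]%classic)) => _.
exact: segment_compact.
Qed.

Lemma nsq_ge0 (x : V) : 0 <= nsq x.
Proof. by apply: sumr_ge0 => i _; exact: sqr_ge0. Qed.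

Lemma sqr_le_nsq (x : V) i : x 0 i ^+ 2 <= nsq x.
Proof. by rewrite /nsq (bigD1 i)//= lerDl sumr_ge0// => j _; exact: sqr_ge0. Qed.

(** * Riemann sums over a cubic grid *)

Section Grid.
Variable n : nat.
Hypothesis n0 : (0 < n)%N.
Let h : R := 2 / n%:R.
Definition grid_point (k : {ffun 'I_N -> 'I_n}) : V :=
  \row_i (-1 + (k i)%:R * h).
(** The shift is cyclic; wrapping around is harmless for functions vanishing on the
    boundary of the cube. *)
Definition grid_shift (i : 'I_N) (k : {ffun 'I_N -> 'I_n}) :
  {ffun 'I_N -> 'I_n} := [ffun j => if j == i then ordS (k j) else k j].

Let nR : 0 < n%:R :> R. Proof. by rewrite ltr0n. Qed.
Let h0 : 0 < h. Proof. by rewrite divr_gt0. Qed.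
Let nh : n%:R * h = 2. Proof. by rewrite mulrC divfK// gt_eqF. Qed.

Lemma grid_shift_bij i : bijective (grid_shift i).
Proof.
exists (fun k : {ffun 'I_N -> 'I_n} => [ffun j => if j == i then ord_pred (k j) else k j]) => k;
  apply/ffunP => j; rewrite !ffunE; case: eqP => //= _.
- exact: ordSK.
- exact: ord_predK.
Qed.

Lemma grid_point_cube k : cube (grid_point k).
Proof.
move=> i; rewrite mxE in_itv /= lerDl mulr_ge0 ?(ltW h0)//=.
rewrite -lerBrDl opprK -[1 + 1]/(2 : R) -nh ler_pM2r// ler_nat.
exact/ltnW/ltn_ord.
Qed.

Lemma grid_shiftE (g : V -> R) i k : (forall x, 1 <= nsq x -> g x = 0) ->
  g (h *: delta_mx 0 i + grid_point k) = g (grid_point (grid_shift i k)).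
Proof.
move=> g0; have [lt|] := ltnP (k i).+1 n.
  congr g; apply/rowP => j; rewrite !mxE !ffunE eqxx /=.
  case: eqVneq => [->|ji]; last by rewrite mulr0 add0r.
  rewrite mulr1 /= modn_small// -natr1; ring.
(* In the wrapping case the [i]-th coordinates of the two points are 1 and -1, so both satisfy
   [1 <= nsq] and [g] vanishes there. *)
move=> ge; have E : (k i).+1 = n by apply/eqP; rewrite eqn_leq ge andbT ltn_ord.
rewrite !g0//; apply: (le_trans _ (sqr_le_nsq _ i)); rewrite !mxE.
  rewrite ffunE eqxx /= E modnn mul0r addr0 sqrrN expr1n//.
rewrite !eqxx /= mulr1 addrCA -[X in X + _ * _]mul1r -mulrDl.
by rewrite nat1r E nh (_ : -1 + 2 = 1) ?expr1n//; ring.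
Qed.

(** The mean value theorem replaces [D i] at a grid point by a difference quotient of [g i], up to
    [e]. The quotients sum to zero because [grid_shift i] permutes the grid; only the errors
    remain. *)
Lemma grid_sum_derive (g D : 'I_N -> V -> R) (e d : R) :
  (forall i x, is_derive x (delta_mx 0 i) (g i) (D i x)) ->
  (forall i x, 1 <= nsq x -> g i x = 0) ->
  h * \sum_(i < N) `|delta_mx 0 i : V| < d ->
  (forall i x y, cube x -> `|y - x| < d -> `|D i y - D i x| < e) ->
  \sum_k \sum_i D i (grid_point k) <= N%:R * e * (n ^ N)%:R.
Proof.
move=> dg g0 hd De.
have M k i : D i (grid_point k) <=
    h^-1 * (g i (grid_point (grid_shift i k)) - g i (grid_point k)) + e.
  have [c|c|c] := @MVT R (fun t => g i (t *: delta_mx 0 i + grid_point k))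
    (fun t => D i (t *: delta_mx 0 i + grid_point k)) 0 h h0.
  - by move=> _; exact: is_derive_line_at.
  - apply: derivable_within_continuous => t _.
    by case: (is_derive_line_at (dg i (t *: delta_mx 0 i + grid_point k))).
  - rewrite in_itv /= => /andP[c0 ch].
    rewrite scale0r add0r subr0 (grid_shiftE _ _ (g0 i)) => ->.
    rewrite [h^-1 * _]mulrC mulfK ?gt_eqF//.
    have := De i (grid_point k) (c *: delta_mx 0 i + grid_point k)
      (grid_point_cube k).
    rewrite addrK => /(_ _)/wrap[].
      rewrite normrZ gtr0_norm// (le_lt_trans _ hd)//.
      apply: ler_pM => //; [exact: ltW|exact: ltW|].
      by rewrite [leRHS](bigD1 i)//= lerDl sumr_ge0.
    by rewrite ltr_norml => /andP[]; lra.
apply: (@le_trans _ _ (\sum_k \sum_i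
    (h^-1 * (g i (grid_point (grid_shift i k)) - g i (grid_point k)) + e))).
  by apply: ler_sum => k _; apply: ler_sum => i _; exact: M.
rewrite exchange_big /=.
rewrite (eq_bigr (fun=> e * (n ^ N)%:R)); last first.
  move=> i _; rewrite big_split /= -mulr_sumr sumrB.
  rewrite -[X in X - _](reindex_inj (bij_inj (grid_shift_bij i))
    (P := xpredT) (F := fun k => g i (grid_point k))) /= subrr mulr0 add0r.
  by rewrite sumr_const card_ffun !card_ord mulr_natr.
by rewrite sumr_const card_ord -mulr_natr; lra.
Qed.

End Grid.

(** In terms of integrals: [f] has integral at most [C 2^N] over the cube of side 2, while [f >= m]
    on a subcube of side [1 / q]. Grid points are counted instead. *)
Lemma nullint_bound (f F : V -> R) (C m : R) (q : nat) : (0 < q)%N -> 0 <= C ->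
  nullint F -> (forall x, nsq x < 1 -> 0 <= f x <= C + F x) ->
  (forall x : V, (forall i, `|x 0 i| <= q%:R^-1) -> nsq x < 1 /\ m <= f x) ->
  m <= C * (2 * q)%:R ^+ N.
Proof.
move=> q0 C0 [g [D [h1 h2 h3 h4 h5]]] Hf Hm.
have [m0|m0] := leP m 0; first by rewrite (le_trans m0)// mulr_ge0// exprn_ge0.
apply/ler_addgt0Pr => e0 e00.
pose A : R := (2 * q)%:R ^+ N.
have A0 : 0 < A by rewrite exprn_gt0// ltr0n muln_gt0.
pose e := e0 / (A * (N%:R + 1)).
have N1 : 0 < N%:R + 1 :> R by rewrite ltr_wpDl.
have e_gt0 : 0 < e by rewrite divr_gt0// mulr_gt0.
have [d d0 dP] := uniform_continuity_family compact_cube h2 e_gt0.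
pose s : R := \sum_(i < N) `|delta_mx 0 i : V|.
have s0 : 0 <= s by rewrite sumr_ge0.
(* With [n = 2 q t] the mesh is [1 / (q t)]: small enough to control the oscillation of [D] over one
   step, and a divisor of the side [1 / q]. *)
pose t := (Num.trunc (s / d)).+1.
have td : s / d < t%:R by exact: truncnS_gt.
have t0 : (0 < t)%N by [].
pose n := (2 * q * t)%N.
have n0 : (0 < n)%N by rewrite !muln_gt0 q0.
have hd : 2 / n%:R * s < d.
  rewrite mulrAC ltr_pdivrMr ?ltr0n// /n !natrM.
  move: td; rewrite ltr_pdivrMr// => td.
  have q1 : 1 <= q%:R :> R by rewrite ler1n.
  have : t%:R * d <= q%:R * (t%:R * d) by rewrite ler_peMl// mulr_ge0// ltW.
  by rewrite [d * _]mulrC; nra.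
have S := grid_sum_derive n0 h1 h3 hd dP.
(* Extension by zero: the upper bound survives outside the ball because [0 <= C] and every [D i]
   vanishes there. *)
pose f1 x := if nsq x < 1 then f x else 0.
have f1D x : f1 x <= C + \sum_i D i x.
  rewrite /f1; case: ltP => x1; first by rewrite -h5//; have /andP[] := Hf x x1.
  by rewrite big1 ?addr0// => i _; exact: h4.
have f10 x : 0 <= f1 x.
  by rewrite /f1; case: ltP => // x1; have /andP[] := Hf x x1.
have U : \sum_(k : {ffun 'I_N -> 'I_n}) f1 (grid_point k) <=
    (C + N%:R * e) * (n ^ N)%:R.
  apply: (le_trans (ler_sum _ (fun k _ => f1D (grid_point k)))).
  rewrite big_split /= sumr_const card_ffun !card_ord -(mulr_natr C) mulrDl.
  by rewrite lerD2l.
(* The indices whose coordinate [-1 + k / (q t)] lies between 0 and [1 / q], right end excluded: [t]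
   of them out of [n]. *)
pose B : {pred 'I_n} := [pred k : 'I_n | (q * t <= k < q * t + t)%N].
have cB : #|B| = t.
  have le : (q * t + t <= n)%N.
    by rewrite /n -mulnA mul2n -addnn leq_add2l leq_pmull.
  pose w (j : 'I_t) : 'I_n := widen_ord le (rshift (q * t) j).
  have wi : injective w by move=> a b /(congr1 val) /= /addnI /val_inj.
  rewrite -[RHS]card_ord -(card_codom wi); apply: eq_card => k.
  rewrite inE; apply/andP/codomP => [[k1 k2]|[j ->] /=]; last first.
    by rewrite leq_addr ltn_add2l.
  have kj : (k - q * t < t)%N by rewrite ltn_subLR.
  by exists (Ordinal kj); apply/val_inj; rewrite /= subnKC.
have L : m * (t ^ N)%:R <= \sum_(k : {ffun 'I_N -> 'I_n}) f1 (grid_point k).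
  rewrite (bigID (mem (ffun_on B))) /=.
  apply: (@le_trans _ _ (\sum_(k | k \in ffun_on B) f1 (grid_point k)));
    last by rewrite lerDl sumr_ge0.
  have <- : \sum_(k : {ffun 'I_N -> 'I_n} | k \in ffun_on B) m = m * (t ^ N)%:R.
    by rewrite sumr_const card_ffun_on cB card_ord mulr_natr.
  apply: ler_sum => k /ffun_onP kB.
  have := Hm (grid_point k) _; rewrite /f1 => /(_ _)/wrap[]; last first.
    by move=> [->].
  move=> i; rewrite mxE; have := kB i; rewrite inE => /andP[k1 k2].
  have qt0 : 0 < (q * t)%:R :> R by rewrite ltr0n muln_gt0 q0.
  have -> : -1 + (k i)%:R * (2 / n%:R) = ((k i)%:R - (q * t)%:R) / (q * t)%:R :> R.
    have -> : n%:R = 2 * (q * t)%:R :> R by rewrite /n -mulnA natrM.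
    by move: ((q * t)%:R : R) qt0 => z z0; field; rewrite gt_eqF.
  rewrite ger0_norm; last by rewrite divr_ge0// subr_ge0 ler_nat.
  rewrite ler_pdivrMr// natrM mulKf ?pnatr_eq0 -?lt0n//.
  by rewrite lerBlDr -natrM -natrD ler_nat addnC ltnW.
have := le_trans L U.
rewrite /n expnMn natrM mulrA ler_pM2r ?ltr0n ?expn_gt0 ?t0//.
rewrite natrX -/A => /le_trans -> //; rewrite mulrDl lerD2l /e.
have -> : N%:R * (e0 / (A * (N%:R + 1))) * A = e0 * (N%:R / (N%:R + 1)).
  by field; rewrite !gt_eqF.
by rewrite ler_piMr ?(ltW e00)// ler_pdivrMr// mul1r lerDl.
Qed.

End NullIntegral.

(** * Cutoff functions *)

Section Cutoff.
Variables (R : realType) (N : nat).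
Local Notation V := 'rV[R]_N.

Definition pospow (k : nat) (t : R) : R := Num.max t 0 ^+ k.

Lemma continuous_pospow k : continuous (pospow k).
Proof.
move=> t; rewrite /pospow.
apply: (@continuous_comp _ _ _ (fun t : R => Num.max t 0) (fun y => y ^+ k)).
  apply: continuous_max; [exact: cvg_id|exact: cst_continuous].
exact: exprn_continuous.
Qed.

Lemma pospowS k (t : R) : pospow k.+2 t = t * pospow k.+1 t.
Proof.
rewrite /pospow [LHS]exprS; have [t0|t0] := leP t 0; last by [].
by rewrite exprS !mul0r mulr0.
Qed.

Lemma is_derive_pospow k (t : R) :
  is_derive t 1 (pospow k.+2) (k.+2%:R * pospow k.+1 t).
Proof.
have [t0|t0|->] := ltgtP t 0.
- have -> : k.+2%:R * pospow k.+1 t = 0.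
    by rewrite /pospow max_r ?(ltW t0)// expr0n mulr0.
  apply: (@near_eq_is_derive _ _ _ (cst 0)).
  near=> y; rewrite /pospow max_r ?expr0n//=; apply: ltW; near: y.
  exact: lt_nbhsl.
- have d : is_derive t 1 (fun y => y ^+ k.+2) (k.+2%:R * pospow k.+1 t).
    rewrite /pospow max_l ?(ltW t0)//.
    by split; [exact: exprn_derivable|rewrite exp_derive /GRing.scale /= mulr1].
  apply: near_eq_is_derive d.
  have : nbhs t [set y | 0 < y].
    by apply: open_nbhs_nbhs; split => //; exact: open_gt.
  by apply: filterS => y /= y0; rewrite /pospow max_l// ltW.
(* At 0 the difference quotient with increment [h] is [pospow k.+1 h], which tends to 0. *)
- have -> : k.+2%:R * pospow k.+1 0 = 0.
    by rewrite /pospow max_r// expr0n mulr0.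
  have H : (fun h : R => h^-1 *: ((pospow k.+2 \o shift 0) (h *: 1) - pospow k.+2 0))
      @ 0^' --> (0 : R).
    have E : {near 0^', pospow k.+1 =1 (fun h : R =>
        h^-1 *: ((pospow k.+2 \o shift 0) (h *: 1) - pospow k.+2 0))}.
      near=> h; rewrite /= addr0 [h *: 1]mulr1 !pospowS mul0r subr0.
      rewrite /GRing.scale /= mulrA mulVf ?mul1r//.
      by near: h; exact: nbhs_dnbhs_neq.
    apply: cvg_trans (near_eq_cvg E) _.
    have := @continuous_pospow k.+1 0; rewrite /continuous_at.
    rewrite {2}/pospow max_r// expr0n /=.
    exact: cvg_within_filter.
  split; first by apply/cvg_ex; exists 0.
  exact: cvg_lim.
Unshelve. all: by end_near. Qed.

Definition cut k (x : V) := pospow k (1 - nsq x).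
Definition dcut k (i : 'I_N) (x : V) := k%:R * pospow k.-1 (1 - nsq x) * (-2 * x 0 i).
Definition ddcut k (i : 'I_N) (x : V) :=
  k%:R * (k.-1%:R * pospow k.-2 (1 - nsq x)) * (-2 * x 0 i * (-2 * x 0 i))
  + k%:R * pospow k.-1 (1 - nsq x) * (-2).

(** The exponent is at least 3, so the second derivatives still contain a positive power of the
    positive part and are continuous across the unit sphere. *)
Lemma C2_cut (U : set V) k : C2 U (cut k.+3) (dcut k.+3) (ddcut k.+3).
Proof.
have H := C2B (@C2_cst R N U 1) (@C2_nsq R N U).
apply: (C2_eq (C2_comp (phi := pospow k.+3)
  (phi' := fun t => k.+3%:R * pospow k.+2 t)
  (phi'' := fun t => k.+3%:R * (k.+2%:R * pospow k.+1 t)) H _ _ _)) => //=.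
- by move=> x _; exact: is_derive_pospow.
- by move=> x _; apply: is_deriveZ; exact: is_derive_pospow.
- move=> x _; apply: continuousM; first exact: cst_continuous.
  by apply: continuousM; [exact: cst_continuous|exact: continuous_pospow].
- by move=> i x; rewrite /dcut /=; ring.
- by move=> i x; rewrite /ddcut /=; ring.
Qed.

Lemma cut_out k (x : V) : 1 <= nsq x -> cut k.+1 x = 0.
Proof. by move=> x1; rewrite /cut /pospow max_r ?expr0n// subr_le0. Qed.

Lemma dcut_out k i (x : V) : 1 <= nsq x -> dcut k.+2 i x = 0.
Proof.
by move=> x1; rewrite /dcut /pospow max_r ?subr_le0// expr0n mulr0 mul0r.
Qed.

Lemma ddcut_out k i (x : V) : 1 <= nsq x -> ddcut k.+3 i x = 0.
Proof.
move=> x1; rewrite /ddcut /pospow max_r ?subr_le0// !expr0n /=.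
by rewrite !(mulr0, mul0r) addr0.
Qed.

Lemma cutE k (x : V) : nsq x < 1 -> cut k x = (1 - nsq x) ^+ k.
Proof. by move=> x1; rewrite /cut /pospow max_l// subr_ge0 ltW. Qed.

Lemma dcutE k i (x : V) : nsq x < 1 ->
  dcut k i x = k%:R * (1 - nsq x) ^+ k.-1 * (-2 * x 0 i).
Proof. by move=> x1; rewrite /dcut /pospow max_l// subr_ge0 ltW. Qed.

Lemma sum_dcut_sqr k (x : V) : nsq x < 1 ->
  \sum_i dcut k i x ^+ 2 = 4 * k%:R ^+ 2 * (1 - nsq x) ^+ k.-1 ^+ 2 * nsq x.
Proof.
move=> x1; rewrite [X in _ = _ * X]/nsq mulr_sumr; apply: eq_bigr => i _.
by rewrite dcutE//; ring.
Qed.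

Lemma sum_ddcut k (x : V) : nsq x < 1 ->
  \sum_i ddcut k i x = 4 * k%:R * k.-1%:R * (1 - nsq x) ^+ k.-2 * nsq x
    - 2 * N%:R * k%:R * (1 - nsq x) ^+ k.-1.
Proof.
move=> x1; rewrite big_split /= sumr_const card_ord /pospow max_l ?subr_ge0 ?ltW//.
congr (_ + _).
  rewrite [X in _ = _ * X]/nsq mulr_sumr; apply: eq_bigr => i _; ring.
by rewrite -mulr_natr; ring.
Qed.

Lemma continuous_nsq : continuous (@nsq R N).
Proof. by move=> x; apply: (C2_nsq setT).1.1. Qed.

Lemma open_nsq_lt c : open [set x : V | nsq x < c].
Proof.
rewrite (_ : [set _ | _] = @nsq R N @^-1` [set y | y < c])//.
by apply: open_comp => [x _|]; [exact: continuous_nsq|exact: open_lt].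
Qed.

Lemma open_nsq_gt c : open [set x : V | c < nsq x].
Proof.
rewrite (_ : [set _ | _] = @nsq R N @^-1` [set y | c < y])//.
by apply: open_comp => [x _|]; [exact: continuous_nsq|exact: open_gt].
Qed.

(** The field is [eta] times the gradient of [w]. A point outside [U] has [1 < nsq], so the field
    vanishes in a neighbourhood of it and is regular there too. *)
Lemma nullint_flux (U : set V) eta deta w dw ddw : open U ->
  (forall x, nsq x <= 1 -> U x) -> C1 U eta deta -> C2 U w dw ddw ->
  (forall x i, 1 <= nsq x ->
     eta x * dw i x = 0 /\ deta i x * dw i x + eta x * ddw i x = 0) ->
  nullint (fun x => \sum_i deta i x * dw i x + eta x * \sum_i ddw i x).
Proof.
move=> oU sU C1e [C1w C2w] out.
pose D i x := deta i x * dw i x + eta x * ddw i x.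
have near0 i (x : V) : ~ U x -> \forall y \near x, eta y * dw i y = 0 /\ D i y = 0.
  move=> Ux; have x1 : 1 < nsq x by rewrite ltNge; apply/negP => /sU.
  have : nbhs x [set y : V | 1 < nsq y].
    by apply: open_nbhs_nbhs; split => //; exact: open_nsq_gt.
  by apply: filterS => y /ltW; exact: out.
exists (fun i x => eta x * dw i x), D; split.
- move=> i x; have [Ux|Ux] := pselect (U x).
    have [_ d1] := C1e.2 i x Ux; have [_ d2] := C2w i x Ux.
    apply: is_derive_eq; rewrite /D /GRing.scale /=; ring.
  have [_ ->] := nbhs_singleton (near0 i x Ux).
  apply: (@near_eq_is_derive _ _ _ (cst 0)).
  by apply: filterS (near0 i x Ux) => y [-> _].
- move=> i x; have [Ux|Ux] := pselect (U x).
    have [c1 _] := C1e.2 i x Ux; have [c2 _] := C2w i x Ux.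
    have c3 := C1e.1 x Ux.
    have [c4 _] := C1w.2 i x Ux.
    by apply: continuousD; apply: continuousM.
  have [_ D0] := nbhs_singleton (near0 i x Ux).
  suff : D i @ x --> D i x by [].
  rewrite D0; apply: (@cvg_near_cst _ _ _ _ (nbhs x)).
  by apply: filterS (near0 i x Ux) => y [_ ->].
- by move=> i x /(out x i) [].
- by move=> i x /(out x i) [].
- by move=> x _; rewrite big_split /= mulr_sumr.
Qed.

End Cutoff.

(** * Reciprocals and real powers of differentiable functions *)

Section MoreCalculus.
Variables (R : realType) (N : nat).
Local Notation V := 'rV[R]_N.
Implicit Types (U : set V) (f : V -> R).

Lemma C1_inv U f df : (forall x, U x -> 0 < f x) -> C1 U f df ->
  C1 U (fun x => (f x)^-1) (fun i x => -1 * ((f x)^-1 * (f x)^-1) * df i x).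
Proof.
move=> f0 [cf hf].
have cV x : U x -> {for x, continuous (fun x => (f x)^-1)}.
  move=> Ux; have fx : f x != 0 by rewrite gt_eqF ?f0.
  exact: cvgV fx (cf x Ux).
split=> // i x Ux; have [cdf d] := hf i x Ux; split.
  apply: continuousM => //; apply: continuousM; first exact: cst_continuous.
  by apply: continuousM; exact: cV.
have fx : f x != 0 by rewrite gt_eqF ?f0.
have [d1 d2] := d.
split; first exact: derivableV.
rewrite deriveV// d2; rewrite /GRing.scale /= -exprVn; ring.
Qed.

Lemma C2_powR U f df ddf a : (forall x, U x -> 0 < f x) -> C2 U f df ddf ->
  C2 U (fun x => f x `^ a) (fun i x => a * f x `^ (a - 1) * df i x)
    (fun i x => a * ((a - 1) * f x `^ (a - 2)) * (df i x * df i x)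
       + a * f x `^ (a - 1) * ddf i x).
Proof.
move=> f0 C.
refine (C2_comp (phi := fun t : R => t `^ a) (phi' := fun t => a * t `^ (a - 1))
  (phi'' := fun t => a * ((a - 1) * t `^ (a - 2))) C _ _ _).
- by move=> x Ux; apply: is_derive1_powR; exact: f0.
- move=> x Ux; have := is_derive1_powR (a - 1) (f0 x Ux).
  rewrite (_ : a - 1 - 1 = a - 2); last by ring.
  by move=> d; exact: is_deriveZ.
- move=> x Ux; apply: continuousM; first exact: cst_continuous.
  apply: continuousM; first exact: cst_continuous.
  apply: differentiable_continuous; apply/derivable1_diffP.
  by have [] := is_derive1_powR (a - 2) (f0 x Ux).
Qed.

Lemma powRS1 (a s : R) : 0 < a -> a `^ (s + 1) = a `^ s * a.
Proof.
move=> a0; rewrite powRD; last by rewrite (gt_eqF a0) implybT.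
by rewrite powRr1// ltW.
Qed.

End MoreCalculus.

Section PolynomialIneq.
Variable R : realType.

(** Coordinatewise form of the fourth-order stability inequality: [X], [z], [w], [S]
    stand for [xi], [zeta], [v] and the cutoff, tested against [w^2 S / z] for [xi],
    [X w^2 S / z^2] for [zeta], [-2 X w S / z] for [v] and [- X w^2 / z] for [S];
    the difference of the two sides is a square. *)
Lemma stability_test_ineq (X z w S dX dz dw dS : R) : 0 < X -> 0 < z -> 0 < S ->
  (dS * (w * w * z^-1) + S * ((dw * w + w * dw) * z^-1
     + w * w * (-1 * (z^-1 * z^-1) * dz))) * dX
  + (dS * (w * w * z^-1 * (X * z^-1)) + S * (((dw * w + w * dw) * z^-1
     + w * w * (-1 * (z^-1 * z^-1) * dz)) * (X * z^-1) + w * w * z^-1 *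
       (dX * z^-1 + X * (-1 * (z^-1 * z^-1) * dz)))) * dz
  - 2 * ((dS * (X * z^-1 * w) + S * ((dX * z^-1 + X * (-1 * (z^-1 * z^-1) * dz)) * w
     + X * z^-1 * dw)) * dw)
  - (((dw * w + w * dw) * z^-1 + w * w * (-1 * (z^-1 * z^-1) * dz)) * X
     + w * w * z^-1 * dX) * dS
  <= - 2 * (X * z^-1 * w) * (dS * dw) + X * z^-1 * (w * w) * (dS ^+ 2 / S) / 2.
Proof.
move=> X0 z0 S0; rewrite -subr_ge0.
rewrite [leRHS](_ : _ =
  2 * X * z^-1 * S^-1 * (S * (dw - w * dz * z^-1) + w * dS / 2) ^+ 2).
  by rewrite mulr_ge0 ?sqr_ge0// !mulr_ge0// ?invr_ge0 ltW.
by field; rewrite !gt_eqF.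
Qed.

End PolynomialIneq.

(** * Integral estimates *)

Ltac nonneg := repeat first
  [ done | exact: ltW | exact: sqr_ge0 | exact: powR_ge0 | exact: nsq_ge0
  | exact: ler0n | rewrite invr_ge0 | apply: exprn_ge0 | apply: mulr_ge0
  | apply: addr_ge0 ].

Ltac positive := repeat first
  [ done | rewrite ltr0n | apply: powR_gt0 | rewrite invr_gt0
  | apply: exprn_gt0 | apply: mulr_gt0 | apply: addr_gt0 ].

Section Systems.
Variables (R : realType) (N : nat) (p theta : R).
Local Notation V := 'rV[R]_N.

Definition LE_pair (U : set V) u du ddu v dv ddv :=
  [/\ C2 U u du ddu, C2 U v dv ddv, forall x, U x -> 0 < u x /\ 0 < v x,
    forall x, U x -> - \sum_i ddu i x = v x `^ p &
    forall x, U x -> - \sum_i ddv i x = u x `^ theta].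

(** Positive supersolution of the system linearised at [(u, v)]. *)
Definition LE_supersolution (U : set V) u v xi dxi ddxi ze dze ddze :=
  [/\ C2 U xi dxi ddxi, C2 U ze dze ddze,
    forall x, U x -> 0 < xi x /\ 0 < ze x,
    forall x, U x -> p * v x `^ (p - 1) * ze x <= - \sum_i ddxi i x &
    forall x, U x -> theta * u x `^ (theta - 1) * xi x <= - \sum_i ddze i x].

End Systems.

Definition rho (R : realType) (N : nat) (x : 'rV[R]_N) : R := 1 - nsq x.

Lemma rho_gt0 (R : realType) (N : nat) (x : 'rV[R]_N) : nsq x < 1 -> 0 < rho x.
Proof. by rewrite subr_gt0. Qed.

Lemma rho_le1 (R : realType) (N : nat) (x : 'rV[R]_N) : rho x <= 1.
Proof. by rewrite lerBlDr lerDl nsq_ge0. Qed.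

(** * Weighted gradient estimate *)

Section GradientIneq.
Variable R : realType.

(** [B] stands for [u^(-t)]; the quadratic form in [(v du / u, dv)] on the right is
    [t/2 (a - b)^2 + (1 - t/2) b^2], which is why [t < 2] is required. *)
Lemma gradient_test_ineq (t B u v chi du dv dchi : R) : 0 < t < 2 -> 0 < B -> 0 < u ->
  0 < chi ->
  (1 - t / 2) / 2 * (B * u * chi * dv ^+ 2)
   - (1 / (8 * t) + 1 / (8 * (1 - t / 2))) * (B * u * v ^+ 2 * (dchi ^+ 2 / chi))
  <= (dchi * (B * u * v) + chi * ((1 - t) * B * du * v + B * u * dv)) * dv
   - (dchi * (2^-1 * B * (v * v)) + chi * (2^-1 * (- t * (B / u) * du) * (v * v)
       + 2^-1 * B * (dv * v + v * dv))) * du.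
Proof.
move=> /andP[t0 t2] B0 u0 chi0; rewrite -subr_ge0.
have s0 : 0 < 1 - t / 2 by lra.
rewrite [leRHS](_ : _ = B * u / chi *
  (t / 2 * (chi * (v * du / u - dv) - v * dchi / (2 * t)) ^+ 2
   + (1 - t / 2) / 2 * (chi * dv + v * dchi / (2 * (1 - t / 2))) ^+ 2)).
  apply: mulr_ge0; first by rewrite divr_ge0 ?mulr_ge0// ltW.
  by rewrite addr_ge0// mulr_ge0 ?sqr_ge0// divr_ge0// ltW.
field.
by rewrite !gt_eqF//=; lra.
Qed.

Lemma weighted_AMGM (a x y : R) : 0 < a -> 2 * (x * y) <= a * x ^+ 2 + y ^+ 2 / a.
Proof.
move=> a0; rewrite -subr_ge0 [leRHS](_ : _ = a * (x - y / a) ^+ 2).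
  by rewrite mulr_ge0 ?sqr_ge0// ltW.
by field; rewrite gt_eqF.
Qed.

End GradientIneq.

Section IntegralEstimates.
Variables (R : realType) (N : nat) (p t : R).
Local Notation V := 'rV[R]_N.
Variables (U : set V) (u v : V -> R) (du dv ddu ddv : 'I_N -> V -> R).
Hypothesis oU : open U.
Hypothesis sU : forall x, nsq x <= 1 -> U x.
Hypothesis LE : LE_pair p t U u du ddu v dv ddv.

(** Integration by parts of the Laplacian of [w] against the test function [eta] times the
    cutoff. *)
Lemma nullint_cut_flux k eta deta w dw ddw : C1 U eta deta -> C2 U w dw ddw ->
  nullint (fun x => \sum_i (dcut k.+3 i x * eta x + cut k.+3 x * deta i x) * dw i x
     + cut k.+3 x * eta x * \sum_i ddw i x).
Proof.
move=> C1e C2w; apply: (nullint_flux oU sU _ C2w).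
  by apply: C1M => //; exact: (C2_cut _ _).1.
by move=> x i x1; rewrite cut_out// dcut_out// !(mul0r, addr0).
Qed.

(** Integration by parts with the Laplacian falling on the cutoff. *)
Lemma nullint_flux_cut k eta deta : C1 U eta deta ->
  nullint (fun x => \sum_i deta i x * dcut k.+3 i x
     + eta x * \sum_i ddcut k.+3 i x).
Proof.
move=> C1e; apply: (nullint_flux oU sU C1e (C2_cut _ _)).
by move=> x i x1; rewrite dcut_out// ddcut_out// !(mulr0, addr0).
Qed.

(** With [S] the cutoff, test the equation of [v] with [u^(1-t) v S] and subtract that of [u] tested
    with [u^(-t) v^2 S / 2]. The gradient terms form the quadratic form of [gradient_test_ineq]; the
    source term of the second test has a favourable sign and is dropped. *)
Lemma gradient_estimate k : 0 < t < 2 ->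
  exists2 F, nullint F & forall x, nsq x < 1 ->
   (1 - t / 2) / 2 * (u x `^ (1 - t) * rho x ^+ k.+3 * \sum_i dv i x ^+ 2) <=
   u x * v x * rho x ^+ k.+3 +
   (1 / (8 * t) + 1 / (8 * (1 - t / 2))) * (4 * k.+3%:R ^+ 2)
     * (u x `^ (1 - t) * v x ^+ 2 * rho x ^+ k.+1) + F x.
Proof.
move=> t02; have [Cu Cv pos equ eqv] := LE; have /andP[t0 t2] := t02.
have pu x : U x -> 0 < u x by move=> /pos[].
have pv x : U x -> 0 < v x by move=> /pos[].
have Cub := C2_C1 (C2_powR (- t) pu Cu).
have Cua := C2_C1 (C2_powR (1 - t) pu Cu).
have E1 := C1M Cua (C2_C1 Cv).
have E2 := C1M (C1Z 2^-1 Cub) (C1M (C2_C1 Cv) (C2_C1 Cv)).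
have F1 := nullint_cut_flux k E1 Cv.
have F2 := nullint_cut_flux k E2 Cu.
eexists; first exact: nullintD F1 (nullintZ (-1) F2).
move=> x x1 /=; have Ux : U x by apply: sU; exact: ltW.
have ux := pu x Ux; have vx := pv x Ux.
have := eqv x Ux; have := equ x Ux.
set Lu := \sum_i ddu i x; set Lv := \sum_i ddv i x => eu ev.
have -> : Lu = - v x `^ p by rewrite -eu opprK.
have -> : Lv = - u x `^ t by rewrite -ev opprK.
set B := u x `^ (- t).
have B0 : 0 < B by exact: powR_gt0.
have Ba : u x `^ (1 - t) = B * u x by rewrite -(powRS1 _ ux) addrC.
have Bb : u x `^ (1 - t - 1) = B by rewrite /B; congr (_ `^ _); ring.
have Bc : u x `^ (- t - 1) = B / u x.
  have -> : B = u x `^ (- t - 1) * u x by rewrite -powRS1// subrK.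
  by rewrite mulfK// gt_eqF.
have Bt : u x `^ t = B^-1 by rewrite /B powRN invrK.
rewrite Ba Bb Bc Bt.
set chi := cut k.+3 x.
have chiE : chi = rho x ^+ k.+3 by rewrite /chi cutE.
have chi0 : 0 < chi by rewrite chiE exprn_gt0// rho_gt0.
pose c1 := 1 / (8 * t) + 1 / (8 * (1 - t / 2)).
have c10 : 0 <= c1 by rewrite addr_ge0// divr_ge0// mulr_ge0//; lra.
rewrite -/c1.
have H := ler_sum (index_enum 'I_N) (fun i (_ : true) =>
  gradient_test_ineq (v x) (du i x) (dv i x) (dcut k.+3 i x) t02 B0 ux chi0).
move: H; rewrite !sumrB -!mulr_sumr -!mulr_suml sum_dcut_sqr// -/(rho x) -/c1.
set S1 := \sum_i ((_ + _) * dv i x); set S2 := \sum_i ((_ + _) * du i x).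
move=> H.
rewrite [X in _ <= _ + X](_ : _ = S1 - S2 - u x * v x * chi
     + 2^-1 * (chi * B * (v x * v x) * v x `^ p)); last first.
  by field; rewrite gt_eqF.
have P : 0 <= 2^-1 * (chi * B * (v x * v x) * v x `^ p).
  by nonneg.
have Q : 4 * k.+3%:R ^+ 2 * rho x ^+ k.+3.-1 ^+ 2 * nsq x / chi <=
    4 * k.+3%:R ^+ 2 * rho x ^+ k.+1.
  rewrite chiE /= [leLHS](_ : _ = 4 * k.+3%:R ^+ 2 * rho x ^+ k.+1 * nsq x).
    by rewrite ler_piMr ?(ltW x1)//; have r0 := rho_gt0 x1; nonneg.
  by rewrite ![rho x ^+ _.+1]exprS; field; rewrite ?expf_neq0 ?gt_eqF ?rho_gt0.
have Q' : c1 * (B * u x * v x ^+ 2 * (4 * k.+3%:R ^+ 2 * rho x ^+ k.+3.-1 ^+ 2 * nsq x / chi))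
   <= c1 * (B * u x * v x ^+ 2 * (4 * k.+3%:R ^+ 2 * rho x ^+ k.+1)).
  by rewrite ler_wpM2l// ler_wpM2l//; nonneg.
rewrite -chiE.
move: H Q' P; rewrite -/(nsq x); lra.
Qed.

End IntegralEstimates.

(** * Energy balance and the fourth-order form of stability *)

Section StabilityIneq.
Variable R : realType.

(** The weight of [T P^2 S] is split: the part [b] absorbs the term in [u], the part [c] the cutoff
    term in [v]. *)
Lemma complete_squares (b c T S u v P K r r' : R) : 0 < b -> 0 < c -> 0 < T ->
  0 < S -> r ^+ 2 = S * r' ->
  2 * P * (T * u) * S + P * (v * (K * r)) <= (b + c) * T * P ^+ 2 * S
    + T * u ^+ 2 * S / b + K ^+ 2 / 4 * (v ^+ 2 * r') / (c * T).
Proof.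
move=> b0 c0 T0 S0 E; rewrite -subr_ge0.
have -> : r' = r ^+ 2 / S by rewrite E mulrAC divff ?mul1r// gt_eqF.
rewrite [leRHS](_ : _ = T * S * b * (P - u / b) ^+ 2 +
  c * T * S * (P - v * K * r / (2 * c * T * S)) ^+ 2).
  by nonneg.
by field; rewrite !gt_eqF.
Qed.

End StabilityIneq.

Section StabilityEstimate.
Variables (R : realType) (N : nat) (p t : R).
Local Notation V := 'rV[R]_N.
Variables (U : set V) (u v : V -> R) (du dv ddu ddv : 'I_N -> V -> R).
Hypothesis oU : open U.
Hypothesis sU : forall x, nsq x <= 1 -> U x.
Hypothesis LE : LE_pair p t U u du ddu v dv ddv.

(** Green's identity for the tests [u S] and [v S] leaves the gradient terms [u dv - v du] against
    [dS]. Adding the divergence of [u v] times the gradient of [S] turns them into [2 u dv], so only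
    the gradient of [v], controlled by [gradient_estimate], occurs. *)
Lemma energy_balance k e : 0 < e ->
  exists2 F, nullint F & forall x, nsq x < 1 ->
   (1 - e) * (u x `^ (t + 1) * rho x ^+ k.+4.+1) <=
   v x `^ (p + 1) * rho x ^+ k.+4.+1 +
   4 * k.+4.+1%:R ^+ 2 / e * (u x `^ (1 - t) * rho x ^+ k.+3 * \sum_i dv i x ^+ 2) +
   4 * k.+4.+1%:R * k.+4%:R * (u x * v x * rho x ^+ k.+3) + F x.
Proof.
move=> e0; have [Cu Cv pos equ eqv] := LE.
have Cu1 := C2_C1 Cu; have Cv1 := C2_C1 Cv.
have F1 := nullint_cut_flux oU sU k.+2 Cu1 Cv.
have F2 := nullint_cut_flux oU sU k.+2 Cv1 Cu.
have F3 := nullint_flux_cut oU sU k.+2 (C1M Cu1 Cv1).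
exists (fun x => -1 * ((\sum_i (dcut k.+4.+1 i x * u x + cut k.+4.+1 x * du i x) * dv i x
     + cut k.+4.+1 x * u x * \sum_i ddv i x) + -1 *
     (\sum_i (dcut k.+4.+1 i x * v x + cut k.+4.+1 x * dv i x) * du i x
     + cut k.+4.+1 x * v x * \sum_i ddu i x) +
     (\sum_i (du i x * v x + u x * dv i x) * dcut k.+4.+1 i x
     + u x * v x * \sum_i ddcut k.+4.+1 i x))).
  exact: nullintZ (nullintD (nullintD F1 (nullintZ (-1) F2)) F3).
move=> x x1; have Ux : U x by apply: sU; exact: ltW.
have [ux vx] := pos x Ux; have r0 := rho_gt0 x1.
have -> : \sum_i ddu i x = - v x `^ p by rewrite -equ// opprK.
have -> : \sum_i ddv i x = - u x `^ t by rewrite -eqv// opprK.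
rewrite !powRS1// sum_ddcut// -/(rho x).
have Tt : u x `^ t = u x `^ (t - 1) * u x by rewrite -powRS1// subrK.
have Tn : u x `^ (1 - t) = (u x `^ (t - 1))^-1 by rewrite -powRN opprB.
set T := u x `^ (t - 1) in Tt Tn *.
have T0 : 0 < T by exact: powR_gt0.
rewrite cutE// -/(rho x).
(* The weight for which [a u^2 |dS|^2] is at most [e u^(t+1) S]. *)
pose a := e * rho x ^+ k.+4.+1 / (4 * k.+4.+1%:R ^+ 2 * (rho x ^+ k.+4) ^+ 2) * T.
have a0 : 0 < a.
  by rewrite /a; positive.
have H := ler_sum (index_enum 'I_N) (fun i (_ : true) =>
  weighted_AMGM (u x * dcut k.+4.+1 i x) (dv i x) a0).
move: H; rewrite big_split /= -!mulr_suml.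
rewrite (_ : \sum_i a * (u x * dcut k.+4.+1 i x) ^+ 2 =
   a * u x ^+ 2 * \sum_i dcut k.+4.+1 i x ^+ 2); last first.
  by rewrite mulr_sumr; apply: eq_bigr => i _; ring.
rewrite sum_dcut_sqr// -/(rho x) /= => H.
have : a * u x ^+ 2 * (4 * k.+4.+1%:R ^+ 2 * rho x ^+ k.+4 ^+ 2 * nsq x) <=
   e * (T * u x * u x * rho x ^+ k.+4.+1).
  rewrite [leLHS](_ : _ = e * (T * u x * u x * rho x ^+ k.+4.+1) * nsq x).
    by rewrite ler_piMr ?(ltW x1)//; nonneg.
  by rewrite /a; field; rewrite ?expf_neq0 ?pnatr_eq0 ?gt_eqF.
have Ea : (\sum_i dv i x ^+ 2) / a =
   4 * k.+4.+1%:R ^+ 2 / e * (T^-1 * rho x ^+ k.+3 * \sum_i dv i x ^+ 2).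
  rewrite /a 3!(exprS (rho x)).
  by field; rewrite ?expf_neq0 ?pnatr_eq0 ?gt_eqF.
rewrite Ea in H => H'.
have L : \sum_i 2 * (u x * dcut k.+4.+1 i x * dv i x) =
   \sum_i (dcut k.+4.+1 i x * u x + rho x ^+ k.+4.+1 * du i x) * dv i x
   - \sum_i (dcut k.+4.+1 i x * v x + rho x ^+ k.+4.+1 * dv i x) * du i x
   + \sum_i (du i x * v x + u x * dv i x) * dcut k.+4.+1 i x.
  rewrite -sumrB -big_split /=; apply: eq_bigr => i _; ring.
rewrite L in H.
have M : u x * v x * (4 * k.+4.+1%:R * k.+4%:R * rho x ^+ k.+3 * nsq x) <=
   4 * k.+4.+1%:R * k.+4%:R * (u x * v x * rho x ^+ k.+3).
  rewrite [leLHS](_ : _ = 4 * k.+4.+1%:R * k.+4%:R * (u x * v x * rho x ^+ k.+3) * nsq x).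
    by rewrite ler_piMr ?(ltW x1)//; nonneg.
  ring.
have M' : 0 <= u x * v x * (2 * N%:R * k.+4.+1%:R * rho x ^+ k.+4) by nonneg.
rewrite Tt Tn /=; move: H H' M M'; lra.
Qed.

Variables (xi ze : V -> R) (dxi dze ddxi ddze : 'I_N -> V -> R).
Hypothesis super : LE_supersolution p t U u v xi dxi ddxi ze dze ddze.

(** With [P = xi v / ze], the inequality for [ze] provides [t u^(t-1) P^2 S]. The splitting
    [b + 2 c = t] spends the part [b] on the source [2 P u^t S] of the equation of [v], one [c] on
    the product of [P dS] with [dv], and the other on the remaining cutoff terms. *)
Lemma stability_estimate k b c : 0 < b -> 0 < c -> b + 2 * c = t ->
  exists2 F, nullint F & forall x, nsq x < 1 ->
   p * (v x `^ (p + 1) * rho x ^+ k.+4.+1) <=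
   u x `^ (t + 1) * rho x ^+ k.+4.+1 / b +
   4 * k.+4.+1%:R ^+ 2 / c * (u x `^ (1 - t) * rho x ^+ k.+3 * \sum_i dv i x ^+ 2) +
   (2 * k.+4.+1%:R ^+ 2 + 2 * N%:R * k.+4.+1%:R) ^+ 2 / (4 * c)
      * (u x `^ (1 - t) * v x ^+ 2 * rho x ^+ k.+1) + F x.
Proof.
move=> b0 c0 bc; have [Cu Cv pos equ eqv] := LE.
have [Cxi Cze posx eqxi eqze] := super.
have Cv1 := C2_C1 Cv; have Cxi1 := C2_C1 Cxi.
have pze x : U x -> 0 < ze x by move=> /posx[].
have Ciz := C1_inv pze (C2_C1 Cze).
have CA := C1M (C1M Cv1 Cv1) Ciz.
have Com := C1M Cxi1 Ciz.
have F1 := nullint_cut_flux oU sU k.+2 CA Cxi.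
have F2 := nullint_cut_flux oU sU k.+2 (C1M CA Com) Cze.
have F3 := nullint_cut_flux oU sU k.+2 (C1M Com Cv1) Cv.
have F4 := nullint_flux_cut oU sU k.+2 (C1M CA Cxi1).
eexists; first exact: nullintZ (-1) _ (nullintD (nullintD F1 F2)
  (nullintD (nullintZ (-2) F3) (nullintZ (-1) F4))).
move=> x x1 /=; have Ux : U x by apply: sU; exact: ltW.
have [ux vx] := pos x Ux; have r0 := rho_gt0 x1; have [xix zex] := posx x Ux.
have := eqxi x Ux; have := eqze x Ux.
have -> : \sum_i ddv i x = - u x `^ t by rewrite -eqv// opprK.
rewrite sum_ddcut// -/(rho x) !powRS1//.
have Tt : u x `^ t = u x `^ (t - 1) * u x by rewrite -powRS1// subrK.
have Tn : u x `^ (1 - t) = (u x `^ (t - 1))^-1 by rewrite -powRN opprB.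
have Vp : v x `^ p = v x `^ (p - 1) * v x by rewrite -powRS1// subrK.
set T := u x `^ (t - 1) in Tt Tn *.
set W := v x `^ (p - 1) in Vp *.
have T0 : 0 < T by exact: powR_gt0.
rewrite Tt Tn Vp.
set Lx := \sum_i ddxi i x; set Lz := \sum_i ddze i x => Hz Hx.
set S := cut k.+4.+1 x.
have SE : S = rho x ^+ k.+4.+1 by rewrite /S cutE.
have S0 : 0 < S by rewrite SE exprn_gt0.
pose iz := (ze x)^-1; have iz0 : 0 < iz by rewrite /iz invr_gt0.
rewrite -/iz.
set S1 := \sum_i (_ * dxi i x); set S2 := \sum_i (_ * dze i x).
set S3 := \sum_i ((_ + _) * dv i x); set S4 := \sum_i (_ * dcut _ i x).
pose P := xi x * iz * v x.
have P0 : 0 < P by rewrite /P; positive.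
pose M : R := k.+4.+1%:R; rewrite -/M.
have M0 : 0 < M by rewrite ltr0n.
(* The weight for which [a P^2 |dS|^2] is at most [c T P^2 S]. *)
pose a := c * T * S / (4 * M ^+ 2 * (rho x ^+ k.+4) ^+ 2).
have a0 : 0 < a by rewrite /a; positive.
have H1 : S1 + S2 - 2 * S3 - S4 <= \sum_i (- 2 * (P * (dcut k.+4.+1 i x * dv i x))
     + P * v x * (dcut k.+4.+1 i x ^+ 2 / S) / 2).
  rewrite /S1 /S2 /S3 /S4 mulr_sumr -big_split -!sumrB /=; apply: ler_sum => i _.
  have := stability_test_ineq (v x) (dxi i x) (dze i x) (dv i x) (dcut k.+4.+1 i x) xix zex S0.
  by rewrite -/iz /P; lra.
have H2 : \sum_i (- 2 * (P * (dcut k.+4.+1 i x * dv i x))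
     + P * v x * (dcut k.+4.+1 i x ^+ 2 / S) / 2) <=
   a * P ^+ 2 * \sum_i dcut k.+4.+1 i x ^+ 2 + (\sum_i dv i x ^+ 2) / a
     + P * v x / S / 2 * \sum_i dcut k.+4.+1 i x ^+ 2.
  rewrite !mulr_sumr mulr_suml -!big_split /=; apply: ler_sum => i _.
  have := weighted_AMGM (- (P * dcut k.+4.+1 i x)) (dv i x) a0.
  by rewrite sqrrN; lra.
rewrite sum_dcut_sqr// -/(rho x) -/M /= in H2.
have Q1 : a * P ^+ 2 * (4 * M ^+ 2 * rho x ^+ k.+4 ^+ 2 * nsq x) <= c * T * P ^+ 2 * S.
  rewrite [leLHS](_ : _ = c * T * P ^+ 2 * S * nsq x).
    by rewrite ler_piMr ?(ltW x1)//; nonneg.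
  by rewrite /a; field; rewrite ?expf_neq0 ?gt_eqF.
have Q2 : (\sum_i dv i x ^+ 2) / a =
   4 * M ^+ 2 / c * (T^-1 * rho x ^+ k.+3 * \sum_i dv i x ^+ 2).
  rewrite /a SE 3!(exprS (rho x)).
  by field; rewrite ?expf_neq0 ?gt_eqF.
rewrite Q2 in H2.
have Q3 : P * v x / S / 2 * (4 * M ^+ 2 * rho x ^+ k.+4 ^+ 2 * nsq x) <=
   P * (v x * (2 * M ^+ 2 * rho x ^+ k.+3)).
  rewrite [leLHS](_ : _ = P * (v x * (2 * M ^+ 2 * rho x ^+ k.+3)) * nsq x).
    by rewrite ler_piMr ?(ltW x1)//; nonneg.
  rewrite SE 2!(exprS (rho x)).
  by field; rewrite ?expf_neq0 ?gt_eqF.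
have Q4 : P * v x * (2 * N%:R * M * rho x ^+ k.+4) <=
   P * (v x * (2 * N%:R * M * rho x ^+ k.+3)).
  rewrite [leLHS](_ : _ = P * (v x * (2 * N%:R * M * rho x ^+ k.+3)) * rho x).
    by rewrite ler_piMr ?rho_le1//; nonneg.
  by rewrite exprS; ring.
have Q5 : 0 <= P * v x * (4 * M * k.+4%:R * rho x ^+ k.+3 * nsq x) by nonneg.
have G1 : p * W * (v x * v x) * S <= S * (v x * v x * iz) * - Lx.
  rewrite [leLHS](_ : _ = S * (v x * v x * iz) * (p * W * ze x)).
    by rewrite ler_wpM2l//; nonneg.
  by rewrite /iz; field; rewrite gt_eqF.
have G2 : t * T * P ^+ 2 * S <= S * (v x * v x * iz * (xi x * iz)) * - Lz.
  rewrite [leLHS](_ : _ = S * (v x * v x * iz * (xi x * iz)) * (t * T * xi x)).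
    by rewrite ler_wpM2l//; nonneg.
  by rewrite /P; ring.
have E : rho x ^+ k.+3 ^+ 2 = S * rho x ^+ k.+1 by rewrite SE !exprS; ring.
have CS := complete_squares (u x) (v x) P (2 * M ^+ 2 + 2 * N%:R * M) b0 c0 T0 S0 E.
rewrite -bc in G2.
have Z : P * v x * (4 * M * k.+4%:R * rho x ^+ k.+3 * nsq x
     - 2 * N%:R * M * rho x ^+ k.+4) = v x * v x * iz * xi x * (4 * M * k.+4%:R * rho x ^+ k.+3 * nsq x
     - 2 * N%:R * M * rho x ^+ k.+4) by rewrite /P; ring.
have Z3 : P * (T * u x) * S = S * (xi x * iz * v x) * (T * u x).
  by rewrite /P; ring.
have K : (2 * M ^+ 2 + 2 * N%:R * M) ^+ 2 / (4 * c) * (T^-1 * v x ^+ 2 * rho x ^+ k.+1)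
   = (2 * M ^+ 2 + 2 * N%:R * M) ^+ 2 / 4 * (v x ^+ 2 * rho x ^+ k.+1) / (c * T).
  by field; rewrite !gt_eqF.
rewrite K -SE.
move: CS H1 H2 Q1 Q3 Q4 Q5 G1 G2 Z Z3 => /=.
lra.
Qed.

End StabilityEstimate.

(** * Second-order stability estimate *)

Section SecondOrder.
Variable R : realType.

(** Picone's inequality with a cutoff: the difference of the two sides is a square divided by
    [S]. *)
Lemma picone_cutoff_ineq (X w S dX dw dS : R) : 0 < X -> 0 < S ->
  (dS * (w * w * X^-1) + S * ((dw * w + w * dw) * X^-1
     + w * w * (-1 * (X^-1 * X^-1) * dX))) * dX
  <= (dS * w + S * dw) * dw + w ^+ 2 * (dS ^+ 2 / S) / 4.
Proof.
move=> X0 S0; rewrite -subr_ge0.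
rewrite [leRHS](_ : _ = (S * dw + w * dS / 2 - S * w * dX / X) ^+ 2 / S).
  by rewrite divr_ge0 ?sqr_ge0// ltW.
by field; rewrite !gt_eqF.
Qed.

(** By the inequality of the means the right side is at least [2 u^2 sqrt(a b W T)], whatever [X]
    and [z]; the last hypothesis bounds this below by [4 u W v]. Squaring avoids the root. *)
Lemma coupled_AMGM (a b X z T W u v : R) : 0 < a -> 0 < b -> 0 < X -> 0 < z ->
  0 < T -> 0 < W -> 0 < u -> 0 < v -> 4 * (W * v ^+ 2) <= a * b * (T * u ^+ 2) ->
  4 * (u * (W * v)) <= u * u * X^-1 * (a * W * z) + u * u * z^-1 * (b * T * X).
Proof.
move=> a0 b0 X0 z0 T0 W0 u0 v0 H.
have E : u * u * X^-1 * (a * W * z) + u * u * z^-1 * (b * T * X) =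
  u ^+ 2 / (X * z) * (a * W * z ^+ 2 + b * T * X ^+ 2).
  by field; rewrite !gt_eqF.
rewrite E mulrAC ler_pdivlMr; last by positive.
rewrite [leLHS](_ : _ = u * (4 * (W * v) * (X * z))); last by ring.
rewrite [leRHS](_ : _ = u * (u * (a * W * z ^+ 2 + b * T * X ^+ 2))); last by ring.
rewrite ler_pM2l// -ler_sqr ?nnegrE; [|by nonneg|by nonneg].
have : 4 * (a * W * z ^+ 2) * (b * T * X ^+ 2) <= (a * W * z ^+ 2 + b * T * X ^+ 2) ^+ 2.
  rewrite -subr_ge0 [leRHS](_ : _ = (a * W * z ^+ 2 - b * T * X ^+ 2) ^+ 2).
    exact: sqr_ge0.
  by ring.
move=> H1; rewrite [leRHS]exprMn.
apply: (le_trans _ (ler_wpM2l (sqr_ge0 u) H1)).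
rewrite [leLHS](_ : _ = 4 * W * (X * z) ^+ 2 * (4 * (W * v ^+ 2))); last by ring.
rewrite [leRHS](_ : _ = 4 * W * (X * z) ^+ 2 * (a * b * (T * u ^+ 2))); last by ring.
by rewrite ler_wpM2l//; nonneg.
Qed.

End SecondOrder.

Section SecondOrderEstimate.
Variables (R : realType) (N : nat) (p t : R).
Local Notation V := 'rV[R]_N.
Variables (U : set V).
Hypothesis oU : open U.
Hypothesis sU : forall x, nsq x <= 1 -> U x.

(** Two integrations by parts move the Laplacian of [v] onto the cutoff, and only the negative part
    of the Laplacian of the cutoff is kept. *)
Lemma mean_estimate k u v du dv ddu ddv : LE_pair p t U u du ddu v dv ddv ->
  exists2 F, nullint F & forall x, nsq x < 1 ->
   u x `^ t * rho x ^+ k.+3 <= 2 * N%:R * k.+3%:R * (v x * rho x ^+ k.+2) + F x.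
Proof.
move=> [Cu Cv pos equ eqv].
have F1 := nullint_cut_flux oU sU k (C1_cst U 1) Cv.
have F2 := nullint_flux_cut oU sU k (C2_C1 Cv).
eexists; first exact: nullintD (nullintZ (-1) F1) F2.
move=> x x1 /=; have Ux : U x by apply: sU; exact: ltW.
have [ux vx] := pos x Ux; have r0 := rho_gt0 x1.
have -> : \sum_i ddv i x = - u x `^ t by rewrite -eqv// opprK.
rewrite sum_ddcut// cutE// -/(rho x) /=.
rewrite (eq_bigr (fun i => dv i x * dcut k.+3 i x)); last by move=> i _; ring.
have : 0 <= v x * (4 * k.+3%:R * k.+2%:R * rho x ^+ k.+1 * nsq x) by nonneg.
lra.
Qed.

Variables (u v : V -> R) (du dv ddu ddv : 'I_N -> V -> R).
Hypothesis LE : LE_pair p t U u du ddu v dv ddv.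
Variables (xi ze : V -> R) (dxi dze ddxi ddze : 'I_N -> V -> R).
Hypothesis super : LE_supersolution p t U u v xi dxi ddxi ze dze ddze.

(** The tests [u^2 S / xi] and [u^2 S / ze] give at least [4 u v^p S] by [coupled_AMGM]. By Picone
    they cost twice the gradient term of the equation of [u] tested with [u S], that is [2 u v^p S],
    up to cutoff terms. The surplus is the estimate. *)
Lemma second_order_estimate k : 0 < p -> 0 < t ->
  (forall x, U x -> 4 * v x `^ (p + 1) <= p * t * u x `^ (t + 1)) ->
  exists2 F, nullint F & forall x, nsq x < 1 ->
   u x * v x `^ p * rho x ^+ k.+4.+1 <=
   k.+4.+1%:R ^+ 2 * (u x ^+ 2 * rho x ^+ k.+3) + F x.
Proof.
move=> p0 t0 cmp; have [Cu Cv pos equ eqv] := LE.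
have [Cxi Cze posx eqxi eqze] := super.
have Cu1 := C2_C1 Cu.
have pze x : U x -> 0 < ze x by move=> /posx[].
have pxi x : U x -> 0 < xi x by move=> /posx[].
have CA := C1M (C1M Cu1 Cu1) (C1_inv pxi (C2_C1 Cxi)).
have CB := C1M (C1M Cu1 Cu1) (C1_inv pze (C2_C1 Cze)).
have F1 := nullint_cut_flux oU sU k.+2 CA Cxi.
have F2 := nullint_cut_flux oU sU k.+2 CB Cze.
have F3 := nullint_cut_flux oU sU k.+2 Cu1 Cu.
eexists; first exact: nullintD F3 (nullintZ (- 2^-1) (nullintD F1 F2)).
move=> x x1 /=; have Ux : U x by apply: sU; exact: ltW.
have [ux vx] := pos x Ux; have r0 := rho_gt0 x1; have [xix zex] := posx x Ux.
have := eqxi x Ux; have := eqze x Ux; have := cmp x Ux.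
have -> : \sum_i ddu i x = - v x `^ p by rewrite -equ// opprK.
rewrite !powRS1//.
have Tt : u x `^ t = u x `^ (t - 1) * u x by rewrite -powRS1// subrK.
have Vp : v x `^ p = v x `^ (p - 1) * v x by rewrite -powRS1// subrK.
set T := u x `^ (t - 1) in Tt *.
set W := v x `^ (p - 1) in Vp *.
have T0 : 0 < T by exact: powR_gt0.
have W0 : 0 < W by exact: powR_gt0.
rewrite Tt Vp.
set Lx := \sum_i ddxi i x; set Lz := \sum_i ddze i x => H0 Hz Hx.
set S := cut k.+4.+1 x.
have SE : S = rho x ^+ k.+4.+1 by rewrite /S cutE.
have S0 : 0 < S by rewrite SE exprn_gt0.
set S1 := \sum_i ((_ + _) * du i x).
set S2 := \sum_i (_ * dxi i x); set S3 := \sum_i (_ * dze i x).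
pose Q := u x ^+ 2 / S / 4 * \sum_i dcut k.+4.+1 i x ^+ 2.
have H1 : S2 <= S1 + Q.
  rewrite /S1 /S2 /Q mulr_sumr -big_split /=; apply: ler_sum => i _.
  have := picone_cutoff_ineq (u x) (dxi i x) (du i x) (dcut k.+4.+1 i x) xix S0.
  lra.
have H2 : S3 <= S1 + Q.
  rewrite /S1 /S3 /Q mulr_sumr -big_split /=; apply: ler_sum => i _.
  have := picone_cutoff_ineq (u x) (dze i x) (du i x) (dcut k.+4.+1 i x) zex S0.
  lra.
have H3 : Q <= k.+4.+1%:R ^+ 2 * (u x ^+ 2 * rho x ^+ k.+3).
  rewrite /Q sum_dcut_sqr// -/(rho x) /= SE.
  rewrite [leLHS](_ : _ = k.+4.+1%:R ^+ 2 * (u x ^+ 2 * rho x ^+ k.+3) * nsq x).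
    by rewrite ler_piMr ?(ltW x1)//; nonneg.
  by rewrite 2!(exprS (rho x)); field; rewrite ?expf_neq0 ?gt_eqF.
have H4 := @coupled_AMGM R p t (xi x) (ze x) T W (u x) (v x) p0 t0 xix zex T0 W0 ux vx.
have {}H4 : 4 * (u x * (W * v x)) <= u x * u x * (xi x)^-1 * (p * W * ze x)
   + u x * u x * (ze x)^-1 * (t * T * xi x) by apply: H4; move: H0; lra.
have {}H4 : S * (4 * (u x * (W * v x))) <= S * (u x * u x * (xi x)^-1) * (p * W * ze x)
   + S * (u x * u x * (ze x)^-1) * (t * T * xi x).
  by move: H4; rewrite -(ler_pM2l S0); lra.
have H5 : S * (u x * u x * (xi x)^-1) * (p * W * ze x) <= S * (u x * u x * (xi x)^-1) * - Lx.
  by rewrite ler_wpM2l//; nonneg.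
have H6 : S * (u x * u x * (ze x)^-1) * (t * T * xi x) <= S * (u x * u x * (ze x)^-1) * - Lz.
  by rewrite ler_wpM2l//; nonneg.
rewrite -SE; move: H1 H2 H3 H4 H5 H6; lra.
Qed.

End SecondOrderEstimate.

(** * Bounds independent of the solution *)

Section RealPowers.
Variable R : realType.
Implicit Types x y z a b c : R.

Lemma le_1DpowR x a : 0 < x -> 1 <= a -> x <= 1 + x `^ a.
Proof.
move=> x0 a1; have [x1|x1] := leP x 1.
  by rewrite (le_trans x1)// lerDl powR_ge0.
by rewrite (le_trans (le1r_powR (ltW x1) a1))// lerDr.
Qed.

Lemma sqr_le_1DpowR x a : 0 < x -> 2 <= a -> x ^+ 2 <= 1 + x `^ a.
Proof.
move=> x0 a2; have -> : x `^ a = (x ^+ 2) `^ (a / 2).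
  by rewrite -powR_mulrn ?ltW// -powRrM; congr (_ `^ _); field.
by apply: le_1DpowR; rewrite ?exprn_gt0// ler_pdivlMr// mul1r.
Qed.

Lemma powR_comparable x y c a : 0 < x -> x <= y -> y <= c * x -> 1 <= c ->
  x `^ a <= c `^ `|a| * y `^ a.
Proof.
move=> x0 xy ycx c1; have y0 := lt_le_trans x0 xy.
have c0 : 0 < c by exact: lt_le_trans c1.
have [a0|a0] := leP 0 a.
  rewrite (le_trans (ge0_ler_powR a0 _ _ xy)) ?nnegrE ?(ltW x0) ?(ltW y0)//.
  by rewrite ler_peMl ?powR_ge0// -[leLHS](powRr0 c) ler_powR// normr_ge0.
have [d d0 ->] : exists2 d, 0 < d & a = - d.
  by exists (- a); rewrite ?oppr_gt0 ?opprK.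
rewrite normrN gtr0_norm// !powRN ler_pdivlMr ?powR_gt0// mulrC.
rewrite ler_pdivrMr ?powR_gt0//.
rewrite -[leRHS]powRM ?(ltW c0) ?(ltW x0)//.
apply: (ge0_ler_powR (ltW d0)) ycx; rewrite nnegrE; nonneg.
Qed.

(** Either [e z^d r^j >= 1], and multiplying by this factor gives the first term; or
    [z^d < 1 / (e r^j)], and the left side is at most a constant times a power of [r] whose exponent
    is nonnegative because [j <= d (j + m)]. *)
Lemma weighted_young (d e : R) (j m : nat) : 0 < d <= 1 -> 0 < e ->
  j%:R <= d * (j + m)%:R -> exists2 C, 0 <= C & forall z r, 0 < z -> 0 < r <= 1 ->
  z `^ (1 - d) * r ^+ m <= e * (z * r ^+ (j + m)) + C.
Proof.
move=> /andP[d0 d1] e0 jm; exists (e^-1 `^ ((1 - d) / d)); first exact: powR_ge0.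
move=> z r z0 /andP[r0 r1].
have [H|H] := leP 1 (e * (z `^ d * r ^+ j)).
  apply: (@le_trans _ _ (e * (z * r ^+ (j + m)))); last by rewrite lerDl powR_ge0.
  rewrite [leRHS](_ : _ = z `^ (1 - d) * r ^+ m * (e * (z `^ d * r ^+ j))).
    by rewrite ler_peMr// mulr_ge0 ?powR_ge0 ?exprn_ge0// ltW.
  rewrite exprD -{1}[z]powRr1 ?ltW// -{1}(subrK d 1) powRD; last first.
    by rewrite (gt_eqF z0) implybT.
  by ring.
apply: (@le_trans _ _ (e^-1 `^ ((1 - d) / d))); last first.
  by rewrite lerDr mulr_ge0 ?mulr_ge0 ?exprn_ge0// ltW.
have zd : z `^ d <= e^-1 * (r `^ j%:R)^-1.
  rewrite -invfM -[leRHS]mul1r ler_pdivlMr ?mulr_gt0 ?powR_gt0//.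
  by rewrite powR_mulrn ?(ltW r0)//; move/ltW: H; lra.
have q0 : 0 <= (1 - d) / d by rewrite divr_ge0 ?subr_ge0// ltW.
have -> : z `^ (1 - d) = (z `^ d) `^ ((1 - d) / d).
  by rewrite -powRrM; congr (_ `^ _); field; rewrite gt_eqF.
have := ge0_ler_powR q0 _ _ zd; rewrite !nnegrE powR_ge0.
rewrite mulr_ge0 ?invr_ge0 ?powR_ge0 ?(ltW e0)// => /(_ isT isT) H1.
apply: (@le_trans _ _ ((e^-1 * (r `^ j%:R)^-1) `^ ((1 - d) / d) * r ^+ m)).
  by rewrite ler_wpM2r// exprn_ge0// ltW.
rewrite powRM ?invr_ge0 ?powR_ge0 ?(ltW e0)// -mulrA ler_piMr ?powR_ge0//.
rewrite -powRN -powRrM -powR_mulrn ?(ltW r0)//.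
rewrite -powRD; last by rewrite (gt_eqF r0) implybT.
rewrite -[leRHS](powRr0 r); apply: ger_powR; first by rewrite r0.
have -> : - j%:R * ((1 - d) / d) + m%:R = (d * (j + m)%:R - j%:R) / d.
  by rewrite natrD; field; rewrite gt_eqF.
by rewrite divr_ge0 ?subr_ge0// ltW.
Qed.

End RealPowers.

(** * Combination of the integral estimates *)

Section Combination.
Variables (R : realType) (N : nat) (p t : R).
Local Notation V := 'rV[R]_N.

Lemma LE_pair_swap U (u v : V -> R) du dv ddu ddv :
  LE_pair p t U u du ddu v dv ddv -> LE_pair t p U v dv ddv u du ddu.
Proof. by move=> [h1 h2 h3 h4 h5]; split => // x /h3[]. Qed.

(** The integral of [u^2] closes on itself: pass to [u^t], by [mean_estimate] to [v], then to [v^p],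
    by the swapped [mean_estimate] to [u], and absorb [u] in half of [u^2]. *)
Lemma second_order_bound : (0 < N)%N -> 1 <= p -> 2 <= t -> exists2 C, 0 <= C &
  forall (U : set V) u du ddu v dv ddv xi dxi ddxi ze dze ddze, open U ->
  (forall x, nsq x <= 1 -> U x) -> LE_pair p t U u du ddu v dv ddv ->
  LE_supersolution p t U u v xi dxi ddxi ze dze ddze ->
  (forall x, U x -> 4 * v x `^ (p + 1) <= p * t * u x `^ (t + 1)) ->
  exists2 F, nullint F & forall x, nsq x < 1 ->
    u x * v x `^ p * rho x ^+ 12 <= C + F x.
Proof.
move=> N0 p1 t2; pose n : R := N%:R; have n1 : 1 <= n by rewrite ler1n.
pose w := 360 * (n * n); have w0 : 0 <= w by rewrite /w; nra.
pose c := 40 * n + 1 + w ^+ 2.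
have c0 : 0 <= c by rewrite /c addr_ge0 ?sqr_ge0//; lra.
exists (144 * (1 + c)); first by rewrite mulr_ge0// addr_ge0.
move=> U u du ddu v dv ddv xi dxi ddxi ze dze ddze oU sU LE super cmp.
have p0 : 0 < p by lra.
have t0 : 0 < t by lra.
have [F1 nF1 H1] := second_order_estimate oU sU LE super 7 p0 t0 cmp.
have [F2 nF2 H2] := mean_estimate oU sU 7 LE.
have [F3 nF3 H3] := mean_estimate oU sU 6 (LE_pair_swap LE).
exists (fun x => F1 x + 144 * (2 * F2 x + 40 * n * F3 x)).
  exact: nullintD nF1 (nullintZ _ (nullintD (nullintZ _ nF2) (nullintZ _ nF3))).
move=> x x1; have [Cu Cv pos equ eqv] := LE.
have Ux : U x by apply: sU; exact: ltW.
have [ux vx] := pos x Ux; have r0 := rho_gt0 x1.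
move: (H1 x x1) (H2 x x1) (H3 x x1); rewrite -/n => {}H1 {}H2 {}H3.
set r := rho x in r0 H1 H2 H3 *.
have r1 k : 0 <= r ^+ k <= 1.
  by rewrite exprn_ge0 ?(ltW r0)//= exprn_ile1 ?(ltW r0)// rho_le1.
have A1 : u x ^+ 2 * r ^+ 10 <= 1 + u x `^ t * r ^+ 10.
  have := sqr_le_1DpowR ux t2; have := r1 10%N; set U2 := u x ^+ 2; nra.
have A2 : v x * r ^+ 9 <= 1 + v x `^ p * r ^+ 9.
  have := le_1DpowR vx p1; have := r1 9%N; nra.
have A3 : 2 * w * (u x * r ^+ 8) <= u x ^+ 2 * r ^+ 10 + w ^+ 2.
  have /andP[r60 r61] := r1 6%N.
  have : w ^+ 2 * r ^+ 6 <= w ^+ 2 by rewrite ler_piMr// sqr_ge0.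
  have := sqr_ge0 (u x * r ^+ 5 - w * r ^+ 3).
  rewrite [X in 0 <= X](_ : _ = u x ^+ 2 * r ^+ 10 - 2 * w * (u x * r ^+ 8)
    + w ^+ 2 * r ^+ 6); last by ring.
  lra.
have A4 : n * (v x * r ^+ 9) <= n * (1 + v x `^ p * r ^+ 9).
  by rewrite ler_wpM2l//; lra.
have A5 : n * (v x `^ p * r ^+ 9) <= n * (2 * n * 9 * (u x * r ^+ 8) + F3 x).
  by rewrite ler_wpM2l//; lra.
have Ew : w * (u x * r ^+ 8) = 360 * (n * n) * (u x * r ^+ 8) by [].
rewrite /c; move: H1 H2 A1 A3 A4 A5 Ew; lra.
Qed.

(** Stability bounds [p X] by [Y / b] and the balance bounds [(1 - e) Y] by [X], up to lower order
    terms, for the energies [X] of [v] and [Y] of [u]. Since [p t > 1], taking [b] close to [t] and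
    [e] small makes this a bound on both; the gradient terms go into [gradient_estimate]. *)
Lemma energy_estimate k : 0 < p -> 0 < t < 2 -> 1 < p * t ->
  exists2 C, 0 <= C &
  forall (U : set V) u du ddu v dv ddv xi dxi ddxi ze dze ddze, open U ->
  (forall x, nsq x <= 1 -> U x) -> LE_pair p t U u du ddu v dv ddv ->
  LE_supersolution p t U u v xi dxi ddxi ze dze ddze ->
  exists2 F, nullint F & forall x, nsq x < 1 ->
    (v x `^ (p + 1) + u x `^ (t + 1)) * rho x ^+ k.+4.+1 <=
    C * (u x * v x * rho x ^+ k.+3 + u x `^ (1 - t) * v x ^+ 2 * rho x ^+ k.+1) + F x.
Proof.
move=> p0 t02 pt; have /andP[t0 t2] := t02.
(* With this [e] the loss [3 e p t] in [h] below is three quarters of [p t - 1], so [h] stays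
   positive. *)
pose e : R := (p * t - 1) / (4 * (p * t)).
have e0 : 0 < e by rewrite /e divr_gt0 ?mulr_gt0 ?subr_gt0.
have ept : 4 * e * (p * t) = p * t - 1 by rewrite /e; field; rewrite !gt_eqF.
have e4 : e < 1 / 4 by nra.
pose b := (1 - 2 * e) * t; pose c := e * t.
have b0 : 0 < b by rewrite mulr_gt0//; lra.
have c0 : 0 < c by rewrite mulr_gt0.
have bc : b + 2 * c = t by rewrite /b /c; ring.
pose M : R := k.+4.+1%:R.
have M0 : 0 <= M by exact: ler0n.
pose K := (2 * M ^+ 2 + 2 * N%:R * M) ^+ 2 / (4 * c).
have K0 : 0 <= K by rewrite divr_ge0 ?sqr_ge0// mulr_ge0// ltW.
pose g := (1 - t / 2) / 2.
have g0 : 0 < g by rewrite /g; lra.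
pose D := (1 / (8 * t) + 1 / (8 * (1 - t / 2))) * (4 * k.+3%:R ^+ 2).
have D0 : 0 <= D.
  rewrite /D; apply: mulr_ge0; last by rewrite mulr_ge0// sqr_ge0.
  by apply: addr_ge0; apply: divr_ge0 => //; lra.
pose A := 4 * M ^+ 2 / e; have A0 : 0 <= A.
  by apply: divr_ge0; [rewrite mulr_ge0// sqr_ge0|exact: ltW].
pose A' := 4 * M ^+ 2 / c; have A'0 : 0 <= A'.
  by apply: divr_ge0; [rewrite mulr_ge0// sqr_ge0|exact: ltW].
pose L := 4 * M * k.+4%:R; have L0 : 0 <= L by nonneg.
pose h := p * b * (1 - e) - 1.
have h0 : 0 < h.
  have -> : h = p * t - 1 - 3 * e * (p * t) + 2 * e ^+ 2 * (p * t).
    by rewrite /h /b; ring.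
  have : 0 < e ^+ 2 * (p * t) by positive.
  by move=> H; move: ept; lra.
pose s := (1 - e)^-1; have s0 : 0 < s by rewrite invr_gt0; lra.
have se : s * (1 - e) = 1 by rewrite mulVf// gt_eqF//; lra.
pose beta := b * (1 - e); have beta0 : 0 < beta by rewrite mulr_gt0//; lra.
(* From [Y <= s X] up to lower order, [X + Y] costs [(1 + s) X], which is [q] times [h X]. *)
pose q := (1 + s) / h; have q0 : 0 < q by rewrite divr_gt0//; lra.
pose gam := (q * (A + beta * A') + s * A) / g.
have gam0 : 0 <= gam by rewrite /gam; nonneg.
pose C := gam * (1 + D) + (q + s) * L + q * beta * K.
exists C; first by rewrite /C; nonneg.
move=> U u du ddu v dv ddv xi dxi ddxi ze dze ddze oU sU LE super.
have [F1 nF1 H1] := stability_estimate oU sU LE super k b0 c0 bc.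
have [F2 nF2 H2] := gradient_estimate oU sU LE k t02.
have [F3 nF3 H3] := energy_balance oU sU LE k e0.
exists (fun x => gam * F2 x + ((q + s) * F3 x + q * beta * F1 x)).
  exact: nullintD (nullintZ _ nF2) (nullintD (nullintZ _ nF3) (nullintZ _ nF1)).
move=> x x1; have [Cu Cv pos equ eqv] := LE.
have Ux : U x by apply: sU; exact: ltW.
have [ux vx] := pos x Ux; have r0 := rho_gt0 x1.
move: (H1 x x1) (H2 x x1) (H3 x x1).
rewrite -/M -/K -/g -/D -/A -/A' -/L.
set X := v x `^ (p + 1) * _; set Y := u x `^ (t + 1) * _.
set G := u x `^ (1 - t) * _ * _.
set Q := u x * v x * _; set W := u x `^ (1 - t) * v x ^+ 2 * _ => {}H1 {}H2 {}H3.
have Q0 : 0 <= Q by rewrite /Q; nonneg.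
have W0 : 0 <= W by rewrite /W; nonneg.
have I1 : h * X <= (A + beta * A') * G + L * Q + beta * K * W + F3 x + beta * F1 x.
  have : beta * (p * X) <= beta * (Y / b + A' * G + K * W + F1 x).
    by rewrite ler_wpM2l// ltW.
  have -> : beta * (Y / b + A' * G + K * W + F1 x) =
    (1 - e) * Y + beta * (A' * G + K * W + F1 x).
    by rewrite /beta; field; rewrite gt_eqF.
  by rewrite /h -/beta => H; have : p * b * (1 - e) * X = beta * (p * X);
    [rewrite /beta; ring|move: H H3; lra].
have I2 : Y <= s * (X + A * G + L * Q + F3 x).
  have -> : Y = s * ((1 - e) * Y) by rewrite mulrA se mul1r.
  by rewrite ler_wpM2l ?(ltW s0)//; move: H3; lra.
have I3 : (1 + s) * X <= q * ((A + beta * A') * G + L * Q + beta * K * W + F3 x + beta * F1 x).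
  have -> : (1 + s) * X = q * (h * X) by rewrite /q; field; rewrite gt_eqF.
  by rewrite ler_wpM2l// ltW.
have I4 : (q * (A + beta * A') + s * A) * G <= gam * (Q + D * W + F2 x).
  have -> : (q * (A + beta * A') + s * A) * G = gam * (g * G).
    by rewrite /gam; field; rewrite gt_eqF.
  by rewrite ler_wpM2l.
have C1 : 0 <= (gam * D + q * beta * K) * Q by nonneg.
have C2 : 0 <= (gam + (q + s) * L) * W by nonneg.
rewrite mulrDl -/X -/Y /C; move: I2 I3 I4 C1 C2; lra.
Qed.

End Combination.

(** * Absorption of the lower order terms *)

Section FourthOrderBound.
Variables (R : realType) (N : nat) (p t : R).
Local Notation V := 'rV[R]_N.

(** With [Z] the total energy density, [u v] is at most [Z^(1-d/2)] and [u^(1-t) v^2] at most a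
    multiple of [Z^(1-d)], so [weighted_young] absorbs both. The assumptions on [p], [t] and [k] say
    that [d <= 1] and [d (k + 5) >= 4]. *)
Lemma fourth_order_bound k : 0 < p -> 0 < t < 2 -> 1 < p * t ->
  2 * (p * t - 1) <= (p + 1) * (t + 1) ->
  4 * ((p + 1) * (t + 1)) <= 2 * (p * t - 1) * k.+4.+1%:R ->
  exists2 C, 0 <= C &
  forall (U : set V) u du ddu v dv ddv xi dxi ddxi ze dze ddze, open U ->
  (forall x, nsq x <= 1 -> U x) -> LE_pair p t U u du ddu v dv ddv ->
  LE_supersolution p t U u v xi dxi ddxi ze dze ddze ->
  (forall x, U x -> (t + 1) * v x `^ (p + 1) <= (p + 1) * u x `^ (t + 1)) ->
  exists2 F, nullint F & forall x, nsq x < 1 ->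
    (v x `^ (p + 1) + u x `^ (t + 1)) * rho x ^+ k.+4.+1 <= C + F x.
Proof.
move=> p0 t02 pt d1 dk; have /andP[t0 t2] := t02.
have [C C0 HC] := energy_estimate N k p0 t02 pt.
have pt1 : 0 < (p + 1) * (t + 1) by rewrite mulr_gt0//; lra.
pose d := 2 * (p * t - 1) / ((p + 1) * (t + 1)).
have d0 : 0 < d by rewrite divr_gt0// mulr_gt0//; lra.
have dle1 : d <= 1 by rewrite ler_pdivrMr// mul1r.
have d4 : 4%:R <= d * (4 + k.+1)%:R.
  rewrite /d mulrAC ler_pdivlMr// (_ : (4 + k.+1)%:R = k.+4.+1%:R)//.
have d2 : 2%:R <= d / 2 * (2 + k.+3)%:R.
  rewrite (_ : (2 + k.+3)%:R = (4 + k.+1)%:R) ?addnS ?add0n//; move: d4; lra.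
(* [u^(1-t)] is the power [a] of [u^(t+1)]. As [a] may be negative, [Z] must also be bounded by a
   multiple of [u^(t+1)]; the pointwise comparison gives the factor [kap]. *)
pose a := (1 - t) / (t + 1).
pose kap := 1 + (p + 1) / (t + 1).
have kap1 : 1 <= kap by rewrite lerDl divr_ge0//; lra.
pose B := kap `^ `|a|; have B0 : 0 <= B by exact: powR_ge0.
(* Small enough that at most half of the energy is absorbed, whence the factor 2 in the final
   constant. *)
pose e := (4 * (C * (1 + B) + 1))^-1.
have CB : 0 < C * (1 + B) + 1 by rewrite ltr_wpDl//; nonneg.
have e0 : 0 < e by rewrite invr_gt0 mulr_gt0.
have [C1 C10 Y1] := weighted_young (j := 4) (m := k.+1)
  (introT andP (conj d0 dle1)) e0 d4.
have d20 : 0 < d / 2 <= 1 by rewrite divr_gt0//=; lra.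
have [C2 C20 Y2] := weighted_young (j := 2) (m := k.+3) d20 e0 d2.
exists (2 * (C * (C2 + B * C1))); first by nonneg.
move=> U u du ddu v dv ddv xi dxi ddxi ze dze ddze oU sU LE super cmp.
have [F nF H] := HC _ _ _ _ _ _ _ _ _ _ _ _ _ oU sU LE super.
exists (fun x => 2 * F x); first exact: nullintZ.
move=> x x1; have [Cu Cv pos equ eqv] := LE.
have Ux : U x by apply: sU; exact: ltW.
have [ux vx] := pos x Ux; have r0 := rho_gt0 x1.
have := H x x1; have := cmp x Ux.
set X := v x `^ (p + 1); set Y := u x `^ (t + 1) => XY.
have X0 : 0 < X by exact: powR_gt0.
have Y0 : 0 < Y by exact: powR_gt0.
pose Z := X + Y; rewrite -/Z => HZ.
have Z0 : 0 < Z by exact: addr_gt0.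
have YZ : Y <= Z by rewrite lerDr ltW.
have XZ : X <= Z by rewrite lerDl ltW.
have ZY : Z <= kap * Y.
  rewrite /Z /kap mulrDl mul1r addrC lerD2l mulrAC ler_pdivlMr; last by lra.
  by rewrite mulrC.
have p1 : p + 1 != 0 by rewrite gt_eqF// addr_gt0.
have t1 : t + 1 != 0 by rewrite gt_eqF// addr_gt0.
have mono s w : 0 <= s -> 0 < w -> w <= Z -> w `^ s <= Z `^ s.
  by move=> s0 w0 wZ; apply: (ge0_ler_powR s0) => //; rewrite nnegrE ltW.
have q0 c : 0 <= c -> 0 <= c / (p + 1) by move=> c0; rewrite divr_ge0// addr_ge0// ltW.
have q0' c : 0 <= c -> 0 <= c / (t + 1) by move=> c0; rewrite divr_ge0// addr_ge0// ltW.
have vX : v x = X `^ (1 / (p + 1)).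
  by rewrite /X -powRrM mulrC divfK// powRr1// ltW.
have uY : u x = Y `^ (1 / (t + 1)).
  by rewrite /Y -powRrM mulrC divfK// powRr1// ltW.
have Zd s : Z `^ s != 0 by rewrite gt_eqF// powR_gt0.
have uv : u x * v x <= Z `^ (1 - d / 2).
  have -> : 1 - d / 2 = 1 / (t + 1) + 1 / (p + 1).
    by rewrite /d; field; rewrite t1 p1.
  rewrite [Z `^ _]powRD; last by rewrite (gt_eqF Z0) implybT.
  rewrite uY vX; apply: ler_pM; rewrite ?powR_ge0//; apply: mono => //.
    exact: q0'.
  exact: q0.
have uv2 : u x `^ (1 - t) * v x ^+ 2 <= B * Z `^ (1 - d).
  have -> : 1 - d = a + 2 / (p + 1).
    by rewrite /d /a; field; rewrite t1 p1.
  rewrite [Z `^ _]powRD; last by rewrite (gt_eqF Z0) implybT.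
  rewrite mulrA; apply: ler_pM; rewrite ?powR_ge0 ?sqr_ge0//.
    have -> : u x `^ (1 - t) = Y `^ a.
      by rewrite /Y -powRrM; congr (_ `^ _); rewrite /a; field.
    exact: powR_comparable.
  have -> : v x ^+ 2 = X `^ (2 / (p + 1)).
    by rewrite /X -powRrM -powR_mulrn ?(ltW vx)//; congr (_ `^ _); field.
  by apply: mono => //; exact: q0.
have r01 : 0 < rho x <= 1 by rewrite r0 rho_le1.
have {}Y1 := Y1 _ _ Z0 r01.
have {}Y2 := Y2 _ _ Z0 r01.
have Q1 : u x * v x * rho x ^+ k.+3 <= e * (Z * rho x ^+ k.+4.+1) + C2.
  by apply: le_trans Y2; rewrite ler_wpM2r// exprn_ge0// ltW.
have Q2 : u x `^ (1 - t) * v x ^+ 2 * rho x ^+ k.+1 <=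
    B * (e * (Z * rho x ^+ k.+4.+1) + C1).
  apply: (@le_trans _ _ (B * (Z `^ (1 - d) * rho x ^+ k.+1))).
    by rewrite mulrA ler_wpM2r// exprn_ge0// ltW.
  by rewrite ler_wpM2l.
have Q3 := ler_wpM2l C0 (lerD Q1 Q2).
have P0 : 0 <= Z * rho x ^+ k.+4.+1 by nonneg.
have Q4 : C * (1 + B) * e * (Z * rho x ^+ k.+4.+1) <= 1 / 2 * (Z * rho x ^+ k.+4.+1).
  rewrite ler_wpM2r// /e ler_pdivrMr ?mulr_gt0//.
  have : 0 <= C * (1 + B) by nonneg.
  by move: (C * (1 + B)) => w w0; clear -w0; lra.
by clear -HZ Q3 Q4; lra.
Qed.

End FourthOrderBound.

(** * Comparison of the two components *)

Section Comparison.
Variables (R : realType) (N : nat).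
Local Notation V := 'rV[R]_N.

Lemma compact_nsq_le (L : R) : compact [set x : V | nsq x <= L].
Proof.
have box : compact [set x : V | forall i, x ord0 i \in `[(- (1 + L)), (1 + L)] ].
  apply: (@rV_compact _  _ (fun=> `[(- (1 + L)), (1 + L)]%classic)) => _.
  exact: segment_compact.
apply: subclosed_compact box _ => [|x /= xL i].
  rewrite (_ : [set _ | _] = @nsq R N @^-1` [set y | y <= L])//.
  apply: closed_comp; last exact: closed_le.
  by move=> x _; exact: continuous_nsq.
have := le_trans (sqr_le_nsq x i) xL; set y := x 0 i => yL.
rewrite in_itv /= -ler_norml -ler_sqr ?nnegrE//; last first.
  by have := sqr_ge0 y; lra.
rewrite real_normK ?num_real//; have := sqr_ge0 y; nra.
Qed.

Lemma is_derive_exprn n (y : R) : is_derive y 1 (fun y => y ^+ n.+1) (n.+1%:R * y ^+ n).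
Proof.
by split; [exact: exprn_derivable|rewrite exp_derive /GRing.scale /= mulr1].
Qed.

Lemma C2_expr (U : set V) (f : V -> R) df ddf m : C2 U f df ddf ->
  C2 U (fun x => f x ^+ m.+2) (fun i x => m.+2%:R * f x ^+ m.+1 * df i x)
    (fun i x => m.+2%:R * (m.+1%:R * f x ^+ m) * (df i x * df i x)
      + m.+2%:R * f x ^+ m.+1 * ddf i x).
Proof.
move=> C; refine (C2_comp (phi := fun y => y ^+ m.+2)
  (phi' := fun y => m.+2%:R * y ^+ m.+1)
  (phi'' := fun y => m.+2%:R * (m.+1%:R * y ^+ m)) C _ _ _).
- by move=> x _; exact: is_derive_exprn.
- by move=> x _; apply: is_deriveZ; exact: is_derive_exprn.
- move=> x _; apply: continuousM; first exact: cst_continuous.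
  by apply: continuousM; [exact: cst_continuous|exact: exprn_continuous].
Qed.

(** Apply the maximum principle to [w (L - |x|^2)^k - A] with [k e >= 2], where [A] is
    of order [L^(k - 1/e)]; then let [L] tend to infinity. *)
Lemma keller_osserman (w : V -> R) dw ddw (c e : R) : C2 setT w dw ddw ->
  0 < c -> 0 < e ->
  (forall x, 0 < w x -> c * w x `^ e * w x <= \sum_i ddw i x) ->
  forall x, w x <= 0.
Proof.
move=> Cw c0 e0 H x0; rewrite leNgt; apply/negP => w0.
pose m := Num.trunc (2 / e).
have mE : 2 <= e * m.+2%:R.
  rewrite -ler_pdivrMl// mulrC (le_trans (ltW (truncnS_gt _)))//.
  by rewrite ler_nat.
pose k : R := m.+2%:R; have k0 : 0 < k by rewrite ltr0n.
(* With [r = L - |x|^2], at a critical point of [w r^k] the terms of its Laplacian other than [r^k]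
   times that of [w] are at least [- K L w r^m]. The choice of [A0] makes [c w^e r^2 > K L] wherever
   [w r^k > A]. *)
pose K := 4 * k ^+ 2 + 4 * k + 2 * N%:R * k.
have K0 : 0 < K.
  by rewrite /K ltr_wpDr ?mulr_ge0// ?ltW//; positive.
pose A0 := (K / c) `^ e^-1.
have A00 : 0 < A0 by apply: powR_gt0; positive.
pose C' := 2 ^+ m.+2 * A0 / w x0.
have C'0 : 0 < C' by rewrite /C'; positive.
(* Ensures [L - |x0|^2 >= L / 2] and [L^(1/e) > C'], which contradict
   [w(x0) (L/2)^k <= A0 L^(k-1/e)]. *)
pose L := 2 * nsq x0 + 1 + C' `^ e.
have L1 : 0 < L.
  by rewrite /L addr_gt0 ?powR_gt0// ltr_wpDl ?mulr_ge0 ?nsq_ge0.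
have Lx0 : 2 * nsq x0 <= L.
  by rewrite /L -addrA lerDl addr_ge0 ?powR_ge0.
have LC : C' < L `^ e^-1.
  have {1}-> : C' = (C' `^ e) `^ e^-1.
    by rewrite -powRrM divff ?gt_eqF// powRr1// ltW.
  apply: gt0_ltr_powR; rewrite ?invr_gt0// ?nnegrE ?powR_ge0//; first exact: ltW.
  by rewrite /L ltrDr ltr_wpDl ?mulr_ge0 ?nsq_ge0.
pose A := A0 * L `^ (k - e^-1).
have A_gt0 : 0 < A by rewrite /A mulr_gt0// powR_gt0.
have Cr := C2_expr m (C2B (@C2_cst R N setT L) (@C2_nsq R N setT)).
have Ch := C2B (C2M Cw Cr) (@C2_cst R N setT A).
have MP := maximum_principle (@compact_nsq_le L) (@open_nsq_lt R N L) _
  (C2_sub (@subsetT _ _) Ch) _ _ _.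
have : w x0 * (L - nsq x0) ^+ m.+2 - A <= 0.
  apply: MP.
  - by move=> x _; exact: Ch.1.1.
  - by move=> x /= /ltW.
  - move=> x /= xL /negP; rewrite -leNgt => Lx.
    have -> : L - nsq x = 0 by apply/eqP; rewrite subr_eq0 eq_le xL Lx.
    by rewrite expr0n mulr0 sub0r oppr_le0 ltW.
  - move=> x /= xL hx crit.
    pose r := L - nsq x; have r0 : 0 < r by rewrite subr_gt0.
    have rL : r <= L by rewrite lerBlDr lerDl nsq_ge0.
    rewrite -/r in hx crit *.
    have wr : A < w x * r ^+ m.+2 by rewrite -subr_gt0.
    have wx : 0 < w x by rewrite -(pmulr_lgt0 _ (exprn_gt0 m.+2 r0)) (lt_trans A_gt0).
    have dwE i : dw i x = 2 * k * w x * x 0 i / r.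
      have := crit i; rewrite subr0 sub0r -/k exprS => E.
      have q0 : 0 < r ^+ m.+1 by exact: exprn_gt0.
      apply: (mulIf (lt0r_neq0 r0)); rewrite divfK ?gt_eqF//.
      by apply: (mulIf (lt0r_neq0 q0)); move: E; clear; lra.
    have -> : \sum_i (ddw i x * r ^+ m.+2 + 2 * (dw i x * (k * r ^+ m.+1 * (0 - 2 * x 0 i)))
       + w x * (k * (m.+1%:R * r ^+ m) * ((0 - 2 * x 0 i) * (0 - 2 * x 0 i))
       + k * r ^+ m.+1 * (0 - 2)) - 0) =
       r ^+ m.+2 * \sum_i ddw i x - (4 * k ^+ 2 + 4 * k) * w x * r ^+ m * nsq x
         - 2 * k * N%:R * w x * r ^+ m.+1.
      rewrite /nsq !mulr_sumr -!sumrN -!big_split.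
      have -> : - (2 * k * N%:R * w x * r ^+ m.+1) =
          \sum_(i < N) - (2 * k * w x * r ^+ m.+1).
        by rewrite sumr_const card_ord -mulr_natr; ring.
      rewrite -!big_split; apply: eq_bigr => i _ /=; rewrite dwE.
      have -> : m.+1%:R = k - 1 by rewrite /k -[m.+2%:R]natr1 addrK.
      by rewrite !exprS; field; rewrite gt_eqF.
    have w_e : K / c * L < w x `^ e * r ^+ 2.
      have ke : 0 <= k * e - 2 by rewrite subr_ge0 mulrC.
      rewrite -(ltr_pM2r (powR_gt0 (k * e - 2) L1)).
      apply: (@le_lt_trans _ _ (A `^ e)).
        rewrite /A /A0 powRM ?powR_ge0// -2!powRrM mulVf ?gt_eqF// powRr1; last first.
          by rewrite divr_ge0 ?ltW.
        rewrite -[leLHS]mulrA ler_pM2l ?divr_gt0//.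
        rewrite -{1}[L]powRr1 ?(ltW L1)// -powRD; last by rewrite (gt_eqF L1) implybT.
        by rewrite le_eqVlt; apply/orP; left; apply/eqP; congr (_ `^ _); field; rewrite gt_eqF.
      apply: (@lt_le_trans _ _ ((w x * r ^+ m.+2) `^ e)).
        by apply: gt0_ltr_powR => //; rewrite nnegrE ltW// (lt_trans A_gt0).
      rewrite powRM ?(ltW wx) ?exprn_ge0 ?(ltW r0)// -mulrA ler_pM2l ?powR_gt0//.
      rewrite -!powR_mulrn ?(ltW r0)// -powRrM.
      have E : m.+2%:R * e = 2%:R + (k * e - 2) by rewrite /k; ring.
      rewrite [X in r `^ X]E powRD; last by rewrite (gt_eqF r0) implybT.
      rewrite ler_pM2l ?powR_gt0//.
      by apply: (ge0_ler_powR ke) rL; rewrite nnegrE ltW.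
    have H1 := H x wx.
    have P : K * (L * (w x * r ^+ m)) < r ^+ m.+2 * \sum_i ddw i x.
      apply: (@lt_le_trans _ _ (r ^+ m.+2 * (c * w x `^ e * w x))); last first.
        by rewrite ler_pM2l ?exprn_gt0.
      rewrite [ltRHS](_ : _ = c * (w x `^ e * r ^+ 2) * (w x * r ^+ m)); last first.
        by rewrite 2!exprS; ring.
      rewrite mulrA ltr_pM2r; last by rewrite mulr_gt0// exprn_gt0.
      rewrite (_ : K * L = c * (K / c * L)); first by rewrite ltr_pM2l.
      by field; rewrite gt_eqF.
    have P1 : (4 * k ^+ 2 + 4 * k) * (nsq x * (w x * r ^+ m)) <=
        (4 * k ^+ 2 + 4 * k) * (L * (w x * r ^+ m)).
      by rewrite ler_wpM2l ?ler_wpM2r ?(ltW xL)//; nonneg.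
    have P2 : 2 * N%:R * k * (r * (w x * r ^+ m)) <= 2 * N%:R * k * (L * (w x * r ^+ m)).
      by rewrite ler_wpM2l ?ler_wpM2r//; nonneg.
    by move: P P1 P2; rewrite /K [r ^+ m.+1]exprS; clear; lra.
  - by move: Lx0 => /=; have := nsq_ge0 x0; lra.
move=> H0.
have : w x0 * (L / 2) ^+ m.+2 <= A.
  apply: le_trans (_ : w x0 * (L - nsq x0) ^+ m.+2 <= A); last first.
    by rewrite -subr_le0.
  rewrite ler_pM2l// lerXn2r ?nnegrE ?divr_ge0 ?(ltW L1)//; last by lra.
  by have := nsq_ge0 x0; lra.
rewrite expr_div_n -powR_mulrn ?(ltW L1)// -/k /A powRB; last first.
  by rewrite (gt_eqF L1) implybT.
set P := L `^ k; set Q := L `^ e^-1; set T := 2 ^+ m.+2.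
have P0 : 0 < P by exact: powR_gt0.
have Q0 : 0 < Q by exact: powR_gt0.
have T0 : 0 < T by exact: exprn_gt0.
rewrite [leLHS](_ : _ = P * (w x0 / T)); last by ring.
rewrite [leRHS](_ : _ = P * (A0 / Q)); last by ring.
rewrite ler_pM2l// ler_pdivlMr// mulrAC ler_pdivrMr//.
apply/negP; rewrite -ltNge.
by move: LC; rewrite /C' ltr_pdivrMr// mulrC [Q * _]mulrC.
Qed.

(** [w = v - l u^s] with [s = (t + 1) / (p + 1)] satisfies [Lap w >= c w^(1 + e)]
    wherever it is positive. *)
Lemma scaling_comparison (p t : R) u du ddu v dv ddv : 0 < t -> t <= p ->
  1 < p * t -> LE_pair p t (@setT V) u du ddu v dv ddv ->
  forall x, (t + 1) * v x `^ (p + 1) <= (p + 1) * u x `^ (t + 1).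
Proof.
move=> t0 tp pt [Cu Cv pos equ eqv].
have p1 : 1 < p by nra.
have p0 : 0 < p by lra.
have pp1 : 0 < p + 1 by lra.
have tt1 : 0 < t + 1 by lra.
pose s := (t + 1) / (p + 1).
have s0 : 0 < s by rewrite divr_gt0.
have s1 : s <= 1 by rewrite ler_pdivrMr// mul1r lerD2r.
(* The value for which [u^t = l s u^(s-1) z^p] with [z = l u^s]. As [s <= 1] the gradient term has a
   good sign, and the Laplacian of [w] is at least [l s u^(s-1) (v^p - z^p)]. *)
pose l := s^-1 `^ (p + 1)^-1.
have l0 : 0 < l by rewrite powR_gt0// invr_gt0.
have lp : l `^ (p + 1) = s^-1.
  by rewrite -powRrM mulVf ?gt_eqF// powRr1// invr_ge0 ltW.
have pu x : setT x -> 0 < u x by move=> _; case: (pos x I).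
have pv x : 0 < v x by case: (pos x I).
have Cw := C2B Cv (C2Z l (C2_powR s pu Cu)).
pose e := (p * t - 1) / (t + 1); have e0 : 0 < e by rewrite divr_gt0// subr_gt0.
(* [u^(s-1)] is a multiple of [z^a]; since [a <= 0], it is at least the same multiple of [v^a] where
   [z < v]. Moreover [a + p - 1 = e]. *)
pose a := (s - 1) / s.
pose c := l * s * l `^ (- a).
have c0 : 0 < c by rewrite /c; positive.
have W := keller_osserman Cw c0 e0.
have {}W : forall x, v x - l * u x `^ s <= 0.
  apply: W => x; have ux := pu x I; have vx := pv x.
  pose z := l * u x `^ s; rewrite -/z => w0.
  have z0 : 0 < z by rewrite /z; positive.
  have zv : z < v x by rewrite -subr_gt0.
  rewrite (_ : \sum_i _ = \sum_i ddv i x - l * (s * ((s - 1) * u x `^ (s - 2)) *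
    \sum_i (du i x * du i x) + s * u x `^ (s - 1) * \sum_i ddu i x)); last first.
    by rewrite mulrDr !mulr_sumr -big_split -sumrB /=; apply: eq_bigr => i _; ring.
  have -> : \sum_i ddv i x = - u x `^ t by rewrite -eqv// opprK.
  have -> : \sum_i ddu i x = - v x `^ p by rewrite -equ// opprK.
  have G0 : 0 <= (1 - s) * (l * s * u x `^ (s - 2) * \sum_i (du i x * du i x)).
    rewrite mulr_ge0 ?subr_ge0// mulr_ge0 ?sumr_ge0//; first by nonneg.
    by move=> i _; rewrite -expr2 sqr_ge0.
  have ut : u x `^ t = l * s * u x `^ (s - 1) * z `^ p.
    rewrite /z powRM ?powR_ge0 ?(ltW l0)// -powRrM.
    rewrite [RHS](_ : _ = s * (l `^ p * l) * (u x `^ (s - 1) * u x `^ (s * p)));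
      last by ring.
    rewrite -powRS1// lp mulfV ?gt_eqF// mul1r -powRD; last by rewrite (gt_eqF ux) implybT.
    by congr (_ `^ _); rewrite /s; field; rewrite gt_eqF.
  have vz : v x `^ (p - 1) * (v x - z) <= v x `^ p - z `^ p.
    have Vp y : 0 < y -> y `^ p = y `^ (p - 1) * y by move=> y0; rewrite -powRS1// subrK.
    rewrite (Vp _ vx) (Vp _ z0) mulrBr lerD2l lerN2 ler_pM2r//.
    by apply: ge0_ler_powR; rewrite ?subr_ge0 ?nnegrE ?ltW.
  have a0 : a <= 0 by rewrite /a pmulr_lle0 ?invr_gt0// subr_le0.
  have us : l `^ (- a) * v x `^ a <= u x `^ (s - 1).
    have -> : u x `^ (s - 1) = l `^ (- a) * z `^ a.
      rewrite /z powRM ?powR_ge0 ?(ltW l0)// mulrA -powRD; last first.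
        by rewrite (gt_eqF l0) implybT.
      rewrite addNr powRr0 mul1r -powRrM; congr (_ `^ _).
      by rewrite /a mulrC divfK// gt_eqF.
    have inv y : y `^ a = (y `^ (- a))^-1 by rewrite powRN invrK.
    rewrite ler_pM2l; last exact: powR_gt0.
    rewrite (inv (v x)) (inv z) lef_pV2 ?posrE ?powR_gt0//.
    have na : 0 <= - a by rewrite oppr_ge0.
    by apply: (ge0_ler_powR na) (ltW zv); rewrite nnegrE ltW.
  have ve : v x `^ a * v x `^ (p - 1) = v x `^ e.
    rewrite -powRD; last by rewrite (gt_eqF vx) implybT.
    congr (_ `^ _); rewrite /a /s /e; field.
    by rewrite !gt_eqF.
  have we : (v x - z) `^ e <= v x `^ e.
    by apply: (ge0_ler_powR (ltW e0)); rewrite ?nnegrE ?(ltW w0) ?(ltW vx)// gerBl ltW.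
  apply: (@le_trans _ _ (l * s * u x `^ (s - 1) * (v x `^ p - z `^ p))); last first.
    by rewrite mulrBr -ut; move: G0; clear; lra.
  apply: (@le_trans _ _ (l * s * (l `^ (- a) * v x `^ a) * (v x `^ (p - 1) * (v x - z)))).
    rewrite [leRHS](_ : _ = c * (v x `^ a * v x `^ (p - 1)) * (v x - z)); last first.
      by rewrite /c; ring.
    by rewrite ve ler_pM2r// ler_pM2l.
  apply: ler_pM => //; [by nonneg|by nonneg|].
  by rewrite ler_pM2l// mulr_gt0.
move=> x; have ux := pu x I; have := W x; rewrite subr_le0 => H.
have H1 : v x `^ (p + 1) <= (l * u x `^ s) `^ (p + 1).
  by apply: ge0_ler_powR; rewrite ?nnegrE ?(ltW pp1) ?(ltW (pv x)) ?mulr_ge0 ?powR_ge0 ?(ltW l0).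
move: H1; rewrite powRM ?powR_ge0 ?(ltW l0)// lp -powRrM /s divfK ?gt_eqF// invf_div.
by rewrite mulrAC ler_pdivlMr// mulrC.
Qed.

End Comparison.

(** * Non-existence for small exponents *)

Section LowerBounds.
Variables (R : realType) (N : nat).
Hypothesis N0 : (0 < N)%N.
Local Notation V := 'rV[R]_N.

Let n0 : 0 < N%:R :> R. Proof. by rewrite ltr0n. Qed.

Lemma nsq0 : nsq (0 : V) = 0.
Proof. by rewrite /nsq big1// => i _; rewrite mxE expr0n. Qed.

(** Minus the Laplacian of the barrier is [m / 2], not [m]: this leaves the strict inequality that
    [maximum_principle] asks for. *)
Lemma superharmonic_ge_torsion (u : V -> R) du ddu (m L : R) : C2 setT u du ddu ->
  (forall x, 0 < u x) -> 0 < m -> (forall x, nsq x < L -> m <= - \sum_i ddu i x) ->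
  forall x, nsq x <= L -> m * (L - nsq x) / (4 * N%:R) <= u x.
Proof.
move=> Cu pu m0 H x xL; rewrite -subr_le0.
have Ch := C2B (C2Z (m / (4 * N%:R)) (C2B (@C2_cst R N setT L) (@C2_nsq R N setT))) Cu.
rewrite mulrAC.
apply: (maximum_principle (@compact_nsq_le R N L) (@open_nsq_lt R N L) _
  (C2_sub (@subsetT _ _) Ch) _ _ _ xL).
- by move=> y _; exact: Ch.1.1.
- by move=> y /= /ltW.
- move=> y /= yL /negP; rewrite -leNgt => Ly.
  have -> : L - nsq y = 0 by apply/eqP; rewrite subr_eq0 eq_le yL Ly.
  by rewrite mulr0 sub0r oppr_le0 ltW.
- move=> y /= yL _ _; rewrite sumrB sumr_const card_ord -(mulr_natr (_ * (0 - 2))).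
  have -> : m / (4 * N%:R) * (0 - 2) * N%:R = - (m / 2).
    by field; rewrite gt_eqF.
  by have := H y yL; move: m0; clear; lra.
Qed.

(** [|x|^(-2s)] is subharmonic away from 0 because [2 s >= N - 2]. Compare [u] with
    [c (|x|^(-2s) - M^(-s))] on the annulus [1 < |x|^2 < M], where [c] is the minimum of [u] on the
    unit ball. *)
Lemma superharmonic_ge_fundamental (u : V -> R) du ddu (s : R) : C2 setT u du ddu ->
  (forall x, 0 < u x) -> (forall x, \sum_i ddu i x < 0) -> 0 < s ->
  N%:R <= 2 * s + 2 -> exists2 c, 0 < c &
  forall L, 1 <= L -> forall x, nsq x <= L -> c * L `^ (- s) <= u x.
Proof.
move=> Cu pu su s0 Ns.
have ne : [set x : V | nsq x <= 1] !=set0 by exists 0; rewrite /= nsq0.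
have cu : {within [set x : V | nsq x <= 1], continuous u}.
  by apply: continuous_subspaceT => y; exact: Cu.1.1.
have [x0 _ mu] := EVT_min_rV ne (@compact_nsq_le R N 1) cu.
have c0 := pu x0; set c := u x0 in c0 mu.
exists c => // L L1 x xL.
have L0 : 0 < L by exact: lt_le_trans L1.
have Ls1 : L `^ (- s) <= 1.
  by rewrite powRN invf_le1 ?powR_gt0// -(powRr0 L) ler_powR// ltW.
have [x1|x1] := leP (nsq x) 1.
  have : c <= u x by apply: mu; rewrite inE.
  by apply: le_trans; rewrite ler_piMr// ltW.
apply: (@le_trans _ _ (c * nsq x `^ (- s))).
  rewrite ler_pM2l// !powRN lef_pV2 ?posrE ?powR_gt0 ?(lt_trans _ x1)//.
  by apply: (ge0_ler_powR (ltW s0)) xL; rewrite nnegrE ?nsq_ge0 ?(ltW L0).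
rewrite leNgt; apply/negP => ux.
pose d := (c * nsq x `^ (- s) - u x) / 2.
have d0 : 0 < d by rewrite divr_gt0// subr_gt0.
(* Large enough that the correction [c M^(-s)] is at most [d], half the supposed deficit at [x]. *)
pose M := nsq x + (c / d) `^ s^-1.
have cd0 : 0 < c / d by rewrite divr_gt0.
have xM : nsq x <= M by rewrite /M lerDl powR_ge0.
have M1 : 1 < M by exact: lt_le_trans xM.
have M0 : 0 < M by exact: lt_trans M1.
have cM : c * M `^ (- s) <= d.
  rewrite powRN ler_pdivrMr ?powR_gt0// -ler_pdivrMl//.
  have -> : d^-1 * c = ((c / d) `^ s^-1) `^ s.
    by rewrite -powRrM mulVf ?gt_eqF// powRr1 ?(ltW cd0)// mulrC.
  apply: (ge0_ler_powR (ltW s0)); rewrite ?nnegrE ?powR_ge0 ?(ltW M0)//.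
  by rewrite /M lerDr nsq_ge0.
have pn (y : V) : [set y : V | 0 < nsq y] y -> 0 < nsq y by [].
have Ch := C2B (C2Z c (C2B (C2_powR (- s) pn (@C2_nsq R N _))
  (@C2_cst R N _ (M `^ (- s))))) (C2_sub (@subsetT _ _) Cu).
pose K := [set y : V | nsq y <= M] `&` [set y : V | 1 <= nsq y].
pose I := [set y : V | nsq y < M] `&` [set y : V | 1 < nsq y].
have cK : compact K.
  apply: subclosed_compact (@compact_nsq_le R N M) _ => [|y []//].
  apply: closedI.
    rewrite (_ : [set _ | _] = @nsq R N @^-1` [set z | z <= M])//.
    by apply: closed_comp; [move=> z _; exact: continuous_nsq|exact: closed_le].
  rewrite (_ : [set _ | _] = @nsq R N @^-1` [set z | 1 <= z])//.
  by apply: closed_comp; [move=> z _; exact: continuous_nsq|exact: closed_ge].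
have oI : open I by apply: openI; [exact: open_nsq_lt|exact: open_nsq_gt].
have Kx : K x by split => //=; exact: ltW.
have sI : I `<=` [set y : V | 0 < nsq y] by move=> y [_ /= y1]; exact: lt_trans y1.
have hx : 0 < c * (nsq x `^ (- s) - M `^ (- s)) - u x.
  by move: cM d0; rewrite /d mulrBr; lra.
suff : c * (nsq x `^ (- s) - M `^ (- s)) - u x <= 0 by rewrite leNgt hx.
apply: (maximum_principle cK oI _ (C2_sub sI Ch) _ _ _ Kx).
- by move=> y [_ /= y1]; apply: Ch.1.1; exact: lt_le_trans y1.
- by move=> y [/= /ltW h1 /ltW h2].
- move=> y [/= yM y1] nI.
  have [y1'|y1'] := leP (nsq y) 1.
    have -> : nsq y = 1 by apply/eqP; rewrite eq_le y1 y1'.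
    rewrite powR1 subr_le0 (le_trans _ (mu y _)) ?inE//= ler_piMr ?(ltW c0)//.
    by rewrite gerBl powR_ge0.
  have [yM'|yM'] := ltP (nsq y) M; first by case: nI.
  have -> : nsq y = M by apply/eqP; rewrite eq_le yM yM'.
  by rewrite subrr mulr0 sub0r oppr_le0 ltW.
- move=> y [/= yM y1] _ _.
  have y0 : 0 < nsq y by exact: lt_trans y1.
  rewrite sumrB -mulr_sumr.
  have -> : \sum_i (- s * ((- s - 1) * nsq y `^ (- s - 2)) * (2 * y 0 i * (2 * y 0 i))
      + - s * nsq y `^ (- s - 1) * 2 - 0) = 2 * s * nsq y `^ (- s - 1) * (2 * s + 2 - N%:R).
    rewrite (eq_bigr (fun i => 4 * s * (s + 1) * nsq y `^ (- s - 2) * y 0 i ^+ 2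
      + - (2 * s * nsq y `^ (- s - 1)))); last by move=> i _; ring.
    rewrite big_split /= -mulr_sumr -/(nsq y) sumr_const card_ord -(mulr_natr (- _)).
    rewrite (_ : nsq y `^ (- s - 1) = nsq y `^ (- s - 2) * nsq y); first by ring.
    by rewrite -powRS1//; congr (_ `^ _); ring.
  have := su y; have : 0 <= c * (2 * s * nsq y `^ (- s - 1) * (2 * s + 2 - N%:R)).
    have : 0 <= 2 * s + 2 - N%:R by rewrite subr_ge0.
    by move=> h; nonneg.
  by lra.
Qed.

(** The decay is measured in terms of [nsq x = |x|^2], hence [s] is half of the usual
    exponent. *)
Definition lower_bound_rate (u : V -> R) (s : R) := exists2 c, 0 < c &
  forall L, 1 <= L -> forall x, nsq x <= L -> c * L `^ (- s) <= u x.

(** The bound on [u] for [|x|^2 < 2 L] is a lower bound [m] on minus the Laplacian of [v]; on the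
    smaller ball [|x|^2 <= L] the torsion barrier is at least [m L / (4 N)]. *)
Lemma lower_bound_rate_step (p t : R) u du ddu v dv ddv s : 0 < t ->
  LE_pair p t (@setT V) u du ddu v dv ddv ->
  lower_bound_rate u s -> lower_bound_rate v (t * s - 1).
Proof.
move=> t0 [Cu Cv pos equ eqv] [c c0 H].
exists (c `^ t * 2 `^ (- s * t) / (4 * N%:R)); first by positive.
move=> L L1 x xL; have L0 : 0 < L by exact: lt_le_trans L1.
pose m := (c * (2 * L) `^ (- s)) `^ t.
have m0 : 0 < m by rewrite powR_gt0// mulr_gt0// powR_gt0// mulr_gt0.
have pv y : 0 < v y by case: (pos y I).
have L2 : 1 <= 2 * L by lra.
have xL2 : nsq x <= 2 * L by lra.
have H1 y : nsq y < 2 * L -> m <= - \sum_i ddv i y.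
  move=> yL; rewrite eqv//; apply: (ge0_ler_powR (ltW t0)).
  - by rewrite nnegrE mulr_ge0 ?powR_ge0 ?(ltW c0).
  - by rewrite nnegrE ltW//; case: (pos y I).
  - by apply: H => //; exact: ltW.
apply: le_trans (superharmonic_ge_torsion Cv pv m0 H1 xL2).
apply: (@le_trans _ _ (m * L / (4 * N%:R))); last first.
  rewrite ler_pM2r ?invr_gt0 ?mulr_gt0// ler_pM2l//; lra.
rewrite /m powRM ?powR_ge0 ?(ltW c0)// -powRrM powRM ?(ltW L0)//.
rewrite le_eqVlt; apply/orP; left; apply/eqP.
have -> : - (t * s - 1) = - s * t + 1 by ring.
by rewrite powRS1//; ring.
Qed.

(** With a negative rate, the bound at the origin would grow without limit as [L] increases. *)
Lemma lower_bound_rate_ge0 u s : lower_bound_rate u s -> 0 <= s.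
Proof.
move=> [c c0 H]; rewrite leNgt; apply/negP => s0.
pose L := 1 + (u 0 / c) `^ (- s)^-1.
have ns0 : 0 < - s by rewrite oppr_gt0.
have L1 : 1 <= L by rewrite /L lerDl powR_ge0.
have zL : nsq (0 : V) <= L by rewrite nsq0 (le_trans _ L1).
have u0 : 0 < u 0.
  apply: lt_le_trans (H L L1 0 zL); rewrite mulr_gt0// powR_gt0//.
  exact: lt_le_trans L1.
have := H L L1 0 zL; rewrite -ler_pdivlMl// leNgt => /negP; apply.
have {1}-> : c^-1 * u 0 = ((u 0 / c) `^ (- s)^-1) `^ (- s).
  rewrite -powRrM mulVf ?gt_eqF// powRr1; first exact: mulrC.
  by apply: divr_ge0; exact: ltW.
apply: (gt0_ltr_powR ns0); rewrite ?nnegrE ?powR_ge0 ?(le_trans _ L1)//.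
by rewrite /L ltrDr.
Qed.

(** Two steps turn the rate [s] into [p (t s - 1) - 1], which is smaller by at least a fixed amount;
    iteration ends at a negative rate. *)
Lemma no_positive_solution (p t s0 : R) u du ddu v dv ddv : 0 < p -> 0 < t ->
  LE_pair p t (@setT V) u du ddu v dv ddv -> 0 < s0 -> N%:R - 2 <= s0 ->
  (p * t - 1) * s0 < 2 * p + 2 -> False.
Proof.
move=> p0 t0 LE s00 Ns H.
have base : lower_bound_rate u (s0 / 2).
  have [Cu Cv pos equ eqv] := LE.
  apply: (superharmonic_ge_fundamental Cu).
  - by move=> x; case: (pos x I).
  - move=> x; rewrite -oppr_gt0 equ// powR_gt0//; by case: (pos x I).
  - by rewrite divr_gt0.
  - by lra.
(* The guaranteed decrease [p + 1 - (p t - 1) s]; the maximum with 0 covers [p t <= 1], where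
   [s >= 0] suffices. *)
pose g := p + 1 - Num.max (p * t - 1) 0 * (s0 / 2).
have g0 : 0 < g.
  by rewrite /g; case: (leP (p * t - 1) 0) => _; [rewrite mul0r|]; lra.
have it n : exists2 s, lower_bound_rate u s & s <= s0 / 2 - n%:R * g.
  elim: n => [|n [s Hs sn]]; first by exists (s0 / 2); rewrite ?mul0r ?subr0.
  have Hv := lower_bound_rate_step t0 LE Hs.
  have Hu := lower_bound_rate_step p0 (LE_pair_swap LE) Hv.
  exists (p * (t * s - 1) - 1) => //.
  have s_ge0 := lower_bound_rate_ge0 Hs.
  have : (p * t - 1) * s <= Num.max (p * t - 1) 0 * (s0 / 2).
    apply: (@le_trans _ _ (Num.max (p * t - 1) 0 * s)).
      by rewrite ler_wpM2r// le_max lexx.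
    rewrite ler_wpM2l ?le_max ?lexx ?orbT// (le_trans sn)// gerBl.
    by rewrite mulr_ge0// ltW.
  have -> : Num.max (p * t - 1) 0 * (s0 / 2) = p + 1 - g by rewrite /g; ring.
  by rewrite -[n.+1%:R]natr1; move: sn; clear; lra.
have [s Hs] := it (Num.trunc (s0 / 2 / g)).+1.
have := truncnS_gt (s0 / 2 / g); rewrite ltr_pdivrMr// => h1 h2.
by have := lower_bound_rate_ge0 Hs; lra.
Qed.

End LowerBounds.

(** * Balls, dilations and conclusion *)

Section Domain.
Variables (R : realType) (N : nat).
Local Notation V := 'rV[R]_N.

Lemma smooth_on_C2 (U : set V) (f : V -> R) : smooth_on U f ->
  C2 U f (fun i => partial i f) (fun i => partial i (partial i f)).
Proof.
move=> sf; split; last first.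
  move=> i x Ux; split; first by have [] := sf [:: i; i] x Ux.
  by apply: derivableP; have [_] := sf [:: i] x Ux; apply.
split=> [x Ux|i x Ux]; first by have [] := sf [::] x Ux.
split; first by have [] := sf [:: i] x Ux.
by apply: derivableP; have [_] := sf [::] x Ux; apply.
Qed.

(** A class closed under partial derivatives, so that [|x|^2 - L] is seen to be smooth to all
    orders. *)
Definition quadratic (a : R) (b : 'I_N -> R) (c : R) (x : V) :=
  a * nsq x + \sum_j b j * x 0 j + c.

Lemma C2_quadratic a b c : C2 setT (quadratic a b c)
  (fun i => quadratic 0 (fun j => 2 * a * (i == j)%:R) (b i)) (fun _ _ => 2 * a).
Proof.
have S := C2_sum (index_enum 'I_N) (fun j => C2Z (b j) (C2_coord setT j)).
refine (C2_eq (C2D (C2D (C2Z a (C2_nsq setT)) S) (C2_cst setT c)) _ _ _) => //=.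
- move=> i x; rewrite /quadratic mul0r add0r addr0; congr (_ + _).
    rewrite (bigD1 i)//= big1 ?addr0 ?eqxx ?mulr1n; first by ring.
    by move=> j ji; rewrite eq_sym (negbTE ji) mulr0n; ring.
  rewrite (bigD1 i)//= big1 ?addr0 ?eqxx ?mulr1n; first by ring.
  by move=> j ji; rewrite eq_sym (negbTE ji) mulr0n; ring.
- by move=> i x; rewrite big1; [ring|move=> j _; rewrite mulr0].
Qed.

Lemma iter_partial_quadratic s a b c : exists a' b' c',
  iter_partial s (quadratic a b c) = quadratic a' b' c'.
Proof.
elim: s => [|i s [a' [b' [c' E]]]] /=; first by exists a, b, c.
exists 0, (fun j => 2 * a' * (i == j)%:R), (b' i).
rewrite E; apply/funext => x; rewrite /partial.
by have [_ ->] := ((C2_quadratic a' b' c').1.2 i x I).2.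
Qed.

Lemma ball_regular_domain (L : R) : 0 < L ->
  bounded_regular_domain [set x : V | nsq x < L].
Proof.
move=> L0; split.
- by exists 0 => /=; rewrite nsq0.
- exact: open_nsq_lt.
(* The ball is star-shaped: a union of segments through 0. *)
- rewrite (_ : [set _ | _] = \bigcup_(x in [set x : V | nsq x < L])
      ((fun a : R => a *: x) @` `[0, 1])); last first.
    apply/seteqP; split=> [x xL|y [x /= xL [a /=]]].
      by exists x => //; exists 1; rewrite ?scale1r//= in_itv /= ler01 lexx.
    rewrite in_itv /= => /andP[a0 a1] <-.
    apply: le_lt_trans xL; apply: ler_sum => i _; rewrite mxE exprMn.
    by rewrite ler_piMl ?sqr_ge0// expr_le1.
  apply: bigcup_connected.
    by exists 0 => x _; exists 0; rewrite ?scale0r//= in_itv /= ler01 lexx.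
  move=> x _; apply: connected_continuous_connected.
    exact: segment_connected.
  by apply: continuous_subspaceT => a; exact: scalel_continuous.
- have [M [Mr HM]] := compact_bounded (@compact_nsq_le R N L).
  by exists M; split => // y My x /= xL; apply: HM => //=; exact: ltW.
- move=> x [cx nx].
  have xL : nsq x = L.
    apply/eqP; rewrite eq_le; apply/andP; split.
      have cl : closed [set y : V | nsq y <= L].
        rewrite (_ : [set _ | _] = @nsq R N @^-1` [set y | y <= L])//.
        by apply: closed_comp; [move=> y _; exact: continuous_nsq|exact: closed_le].
      have := closure_subset (fun (y : V) (yL : nsq y < L) => ltW yL : nsq y <= L) cx.
      by rewrite -(closure_id _).1.
    rewrite leNgt; apply/negP => h; apply: nx.
    by have /interior_id -> : open [set x : V | nsq x < L] by exact: open_nsq_lt.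
  exists setT, (quadratic 1 (fun=> 0) (- L)); split => //.
  + exact: openT.
  + move=> s y _; have [a [b [c ->]]] := iter_partial_quadratic s 1 (fun=> 0) (- L).
    have C := (C2_quadratic a b c).1.
    by split=> [|i]; [exact: C.1|case: (C.2 i y I) => _ []].
  + have /existsP [i xi] : [exists i, x 0 i != 0].
      apply: contraT; rewrite negb_exists => /forallP H.
      suff : nsq x = 0 by move=> E; move: L0; rewrite -xL E ltxx.
      by rewrite /nsq big1// => i _; move: (H i); rewrite negbK => /eqP ->; rewrite expr0n.
    exists i; rewrite /partial.
    have [_ ->] := ((C2_quadratic 1 (fun=> 0) (- L)).1.2 i x I).2.
    rewrite /quadratic mul0r add0r addr0 (bigD1 i)//= big1 ?addr0 ?eqxx ?mulr1n.
      by rewrite !mulr1 mulf_neq0 ?pnatr_eq0.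
    by move=> j ji; rewrite eq_sym (negbTE ji) mulr0n mulr0 mul0r.
  + move=> y _; rewrite /quadratic mul1r big1 ?addr0 ?subr_lt0//.
    by move=> i _; rewrite mul0r.
Qed.

End Domain.

(** * Dilations and growth of the rescaled energy *)

Section Scaling.
Variables (R : realType) (N : nat).
Local Notation V := 'rV[R]_N.

Lemma nsqZ (a : R) (x : V) : nsq (a *: x) = a ^+ 2 * nsq x.
Proof. by rewrite /nsq mulr_sumr; apply: eq_bigr => i _; rewrite mxE exprMn. Qed.

Lemma is_derive_dilation (f : V -> R) (x v : V) (m l : R) :
  is_derive (m *: x) v f l -> is_derive x v (fun y => f (m *: y)) (m * l).
Proof.
move=> /is_derive_line h; apply/is_derive_line.
rewrite (_ : (fun _ => _) = (fun k => f (k *: v + m *: x)) \o (fun h => m * h)).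
  have d : is_derive (0 : R) 1 (fun h : R => m * h) m.
    by apply: is_derive_eq; rewrite /GRing.scale /= mulr1.
  rewrite [m * l]mulrC; apply: is_derive1_comp.
  by rewrite mulr0.
by apply/funext => k /=; rewrite scalerDr scalerA.
Qed.

Lemma C2_dilation (U : set V) (f : V -> R) df ddf (m : R) : C2 U f df ddf ->
  C2 [set x | U (m *: x)] (fun x => f (m *: x)) (fun i x => m * df i (m *: x))
    (fun i x => m ^+ 2 * ddf i (m *: x)).
Proof.
move=> [[cf hf] hf'].
have cc (g : V -> R) (x : V) : {for m *: x, continuous g} ->
    {for x, continuous (fun x : V => g (m *: x))}.
  by move=> cg; apply: continuous_comp cg; exact: scaler_continuous.
split; last first.
  move=> i x Ux; have [c d] := hf' i _ Ux; split.
    by apply: continuousM; [exact: cst_continuous|exact: cc].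
  rewrite expr2 -mulrA.
  have d' := is_derive_dilation d.
  exact: is_deriveZ.
split=> [x Ux|i x Ux]; first by apply: cc; exact: cf.
have [c d] := hf i _ Ux; split; last exact: is_derive_dilation.
by apply: continuousM; [exact: cst_continuous|exact: cc].
Qed.

Lemma LE_pair_dilation (p t a b m : R) (u v : V -> R) du dv ddu ddv : 0 < m ->
  b * p = a + 2 -> a * t = b + 2 -> LE_pair p t setT u du ddu v dv ddv ->
  LE_pair p t setT
    (fun x => m `^ a * u (m *: x)) (fun i x => m `^ a * (m * du i (m *: x)))
    (fun i x => m `^ a * (m ^+ 2 * ddu i (m *: x)))
    (fun x => m `^ b * v (m *: x)) (fun i x => m `^ b * (m * dv i (m *: x)))
    (fun i x => m `^ b * (m ^+ 2 * ddv i (m *: x))).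
Proof.
move=> m0 bp at_ [Cu Cv pos equ eqv].
have aux c (f : 'I_N -> V -> R) (x : V) : - \sum_i m `^ c * (m ^+ 2 * f i (m *: x)) =
    m `^ (c + 2) * - \sum_i f i (m *: x).
  rewrite mulrN -mulr_sumr -mulr_sumr powRD; last by rewrite (gt_eqF m0) implybT.
  by rewrite (powR_mulrn 2) ?(ltW m0)// mulrA.
split.
- exact: C2Z (C2_dilation m Cu).
- exact: C2Z (C2_dilation m Cv).
- by move=> x _; have [? ?] := pos (m *: x) I; rewrite !mulr_gt0 ?powR_gt0.
- move=> x _; have [_ vx] := pos (m *: x) I.
  by rewrite aux equ// powRM ?powR_ge0 ?(ltW vx)// -powRrM bp.
- move=> x _; have [ux _] := pos (m *: x) I.
  by rewrite aux eqv// powRM ?powR_ge0 ?(ltW ux)// -powRrM at_.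
Qed.

(** Stability on [|x|^2 < 4 m^2], pulled back by the dilation to a neighbourhood of the closed unit
    ball. Dropping the nonnegative term in [eta] leaves inequalities. *)
Lemma stable_supersolution (p t a b m : R) (u v : V -> R) : 0 < m ->
  b * p = a + 2 -> a * t = b + 2 -> (forall x, 0 < u x /\ 0 < v x) ->
  stable p t u v -> exists xi dxi ddxi ze dze ddze,
  LE_supersolution p t [set x | nsq x < 4] (fun x => m `^ a * u (m *: x))
    (fun x => m `^ b * v (m *: x)) xi dxi ddxi ze dze ddze.
Proof.
move=> m0 bp at_ pos st.
have L0 : 0 < 4 * m ^+ 2 by rewrite mulr_gt0// exprn_gt0.
have [eta [xi [ze [eta0 [sxi sze] posx eqxi eqze]]]] := st _ (ball_regular_domain N L0).
have sub (x : V) : nsq x < 4 -> nsq (m *: x) < 4 * m ^+ 2.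
  by move=> x4; rewrite nsqZ mulrC ltr_pM2r ?exprn_gt0.
have Cxi := smooth_on_C2 sxi; have Cze := smooth_on_C2 sze.
have aux c (f : 'I_N -> V -> R) (x : V) : - \sum_i m `^ c * (m ^+ 2 * f i (m *: x)) =
    m `^ (c + 2) * - \sum_i f i (m *: x).
  rewrite mulrN -mulr_sumr -mulr_sumr powRD; last by rewrite (gt_eqF m0) implybT.
  by rewrite (powR_mulrn 2) ?(ltW m0)// mulrA.
have C1' := C2_sub (sub : [set x | nsq x < 4] `<=` _) (C2Z (m `^ a) (C2_dilation m Cxi)).
have C2' := C2_sub (sub : [set x | nsq x < 4] `<=` _) (C2Z (m `^ b) (C2_dilation m Cze)).
exists (fun x => m `^ a * xi (m *: x)), (fun i x => m `^ a * (m * partial i xi (m *: x))),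
  (fun i x => m `^ a * (m ^+ 2 * partial i (partial i xi) (m *: x))),
  (fun x => m `^ b * ze (m *: x)), (fun i x => m `^ b * (m * partial i ze (m *: x))),
  (fun i x => m `^ b * (m ^+ 2 * partial i (partial i ze) (m *: x))).
split; [exact: C1'|exact: C2'|..].
- move=> x /sub /posx [h1 h2]; by rewrite !mulr_gt0 ?powR_gt0.
- move=> x /sub xK /=; have [x1 x2] := posx _ xK; have [_ vx] := pos (m *: x).
  rewrite (aux _ (fun i => partial i (partial i xi))) -bp; have := eqxi _ xK; rewrite /laplacian => ->.
  rewrite powRM ?powR_ge0 ?(ltW vx)// -powRrM.
  have -> : m `^ (b * p) = m `^ (b * (p - 1)) * m `^ b.
    by rewrite -powRD; [congr (_ `^ _); ring|rewrite (gt_eqF m0) implybT].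
  rewrite [leLHS](_ : _ = m `^ (b * (p - 1)) * m `^ b * (p * v (m *: x) `^ (p - 1) * ze (m *: x))); last by ring.
  rewrite ler_wpM2l ?mulr_ge0 ?powR_ge0// lerDl mulr_ge0// ltW//.
- move=> x /sub xK /=; have [x1 x2] := posx _ xK; have [ux _] := pos (m *: x).
  rewrite (aux _ (fun i => partial i (partial i ze))) -at_; have := eqze _ xK; rewrite /laplacian => ->.
  rewrite powRM ?powR_ge0 ?(ltW ux)// -powRrM.
  have -> : m `^ (a * t) = m `^ (a * (t - 1)) * m `^ a.
    by rewrite -powRD; [congr (_ `^ _); ring|rewrite (gt_eqF m0) implybT].
  rewrite [leLHS](_ : _ = m `^ (a * (t - 1)) * m `^ a * (t * u (m *: x) `^ (t - 1) * xi (m *: x))); last by ring.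
  rewrite ler_wpM2l ?mulr_ge0 ?powR_ge0// lerDl mulr_ge0// ltW//.
Qed.

(** When [|x_i| <= 1 / q], the point [q x] stays in a fixed compact ball, where [Z >= z > 0]. Then
    [nullint_bound] makes [q^lam] at most a multiple of [q^N], false for large [q]. *)
Lemma scaling_contradiction (Z : V -> R) (lam C : R) (M : nat) : continuous Z ->
  (forall x, 0 < Z x) -> N%:R < lam -> 0 <= C ->
  (forall q : nat, (0 < q)%N -> exists2 F, nullint F & forall x, nsq x < 1 ->
     q%:R `^ lam * Z (q%:R *: x) * rho x ^+ M <= C + F x) -> False.
Proof.
move=> cZ Z0 Nlam C0 H.
have ne : [set x : V | nsq x <= N%:R] !=set0 by exists 0; rewrite /= nsq0.
have cZ' : {within [set x : V | nsq x <= N%:R], continuous Z}.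
  exact: continuous_subspaceT.
have [x0 _ mZ] := EVT_min_rV ne (@compact_nsq_le R N N%:R) cZ'.
have z0 := Z0 x0; set z := Z x0 in z0 mZ.
pose g := lam - N%:R; have g0 : 0 < g by rewrite subr_gt0.
pose D := (2 ^+ M * C * 2 ^+ N + 1) / z.
have D0 : 0 < D by rewrite divr_gt0// ltr_wpDl ?mulr_ge0 ?exprn_ge0.
(* [q >= 2 N] puts the small cube inside [|x|^2 <= 1/2], where [rho >= 1/2]; the first summand gives
   [q^(lam-N) > D]. *)
pose q := (Num.trunc (D `^ g^-1) + 2 * N + 1)%N.
have q0 : (0 < q)%N by rewrite /q addn1.
have qR : 0 < q%:R :> R by rewrite ltr0n.
have qN : 2 * N%:R <= q%:R :> R.
  by rewrite -natrM ler_nat /q -addnA addnCA leq_addr.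
have qq : q%:R <= q%:R ^+ 2 :> R by rewrite -natrX ler_nat -mulnn leq_pmulr.
have Dq : D < q%:R `^ g.
  have {1}-> : D = (D `^ g^-1) `^ g.
    by rewrite -powRrM mulVf ?gt_eqF// powRr1// ltW.
  apply: (gt0_ltr_powR g0); rewrite ?nnegrE ?powR_ge0 ?ler0n//.
  by rewrite (lt_le_trans (truncnS_gt _))// ler_nat /q addn1 ltnS leq_addr.
have [F nF HF] := H q q0.
have r2 (x : V) : (forall i, `|x 0 i| <= q%:R^-1) -> nsq x <= 1 / 2 /\ z <= Z (q%:R *: x).
  move=> hx.
  have xN : nsq x * q%:R ^+ 2 <= N%:R.
    rewrite /nsq mulr_suml -[leRHS](_ : \sum_(i < N) (1 : R) = _); last first.
      by rewrite sumr_const card_ord.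
    apply: ler_sum => i _; rewrite -exprMn -real_normK ?num_real// expr_le1//.
    by rewrite normrM (ger0_norm (ltW qR)) -ler_pdivlMr// mul1r.
  split; last by apply: mZ; rewrite inE /= nsqZ mulrC.
  rewrite -(ler_pM2r (exprn_gt0 2 qR)); move: xN qN qq; lra.
have P : q%:R `^ lam * z / 2 ^+ M <= C * (2 * q)%:R ^+ N.
  apply: (nullint_bound q0 C0 nF
    (f := fun x => q%:R `^ lam * Z (q%:R *: x) * rho x ^+ M)) => x hx.
    by rewrite HF// andbT !mulr_ge0 ?powR_ge0 ?exprn_ge0 ?(ltW (rho_gt0 hx))// ltW.
  have [x2 zx] := r2 x hx; split; first by move: x2; lra.
  apply: ler_pM; rewrite ?invr_ge0 ?exprn_ge0// ?mulr_ge0 ?powR_ge0 ?(ltW z0)//.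
    by rewrite ler_wpM2l ?powR_ge0.
  rewrite -exprVn lerXn2r ?nnegrE ?invr_ge0//; rewrite /rho; move: x2; lra.
move: P; have -> : lam = g + N%:R by rewrite /g subrK.
rewrite powRD; last by rewrite (gt_eqF qR) implybT.
rewrite powR_mulrn ?(ltW qR)// natrM exprMn.
rewrite [leLHS](_ : _ = q%:R `^ g * z / 2 ^+ M * q%:R ^+ N); last by ring.
rewrite mulrA ler_pM2r ?exprn_gt0// ler_pdivrMr ?exprn_gt0//.
apply/negP; rewrite -ltNge; move: Dq; rewrite /D ltr_pdivrMr//.
by clear; lra.
Qed.

End Scaling.

(** * The theorem for ordered exponents, then by symmetry in general *)

Section Liouville.
Variables (R : realType) (N : nat).
Hypothesis N0 : (0 < N)%N.
Local Notation V := 'rV[R]_N.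

Lemma liouville_ordered (p t : R) (u v : V -> R) : 0 < t -> t <= p ->
  (N%:R - 2) / N%:R < 1 / (p + 1) + 1 / (t + 1) ->
  Lane_Emden_solution p t u v -> stable p t u v -> False.
Proof.
move=> t0 tp sub [su sv pos equ eqv] st.
have p0 : 0 < p by exact: lt_le_trans tp.
have n1 : 1 <= N%:R :> R by rewrite ler1n.
have p1 : 0 < p + 1 by lra.
have t1 : 0 < t + 1 by lra.
have LE : LE_pair p t setT u (fun i => partial i u) (fun i => partial i (partial i u))
    v (fun i => partial i v) (fun i => partial i (partial i v)).
  split; [exact: smooth_on_C2|exact: smooth_on_C2|by move=> x _; exact: pos|..].
  - by move=> x _; exact: equ.
  - by move=> x _; exact: eqv.
have {}sub : N%:R * (p * t - 1) < 2 * ((p + 1) * (t + 1)).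
  move: sub; rewrite ltr_pdivrMr; last by lra.
  have -> : (1 / (p + 1) + 1 / (t + 1)) * N%:R =
      (p + t + 2) * N%:R / ((p + 1) * (t + 1)).
    by field; rewrite !gt_eqF.
  rewrite ltr_pdivlMr ?mulr_gt0//; lra.
(* For [N <= 2] any positive starting exponent is allowed, and [(p + 1) / (p t)] also meets the
   upper bound. *)
have [N2|N3] := leqP N 2.
  have n2 : N%:R <= 2 :> R by rewrite ler_nat.
  have pt0 : 0 < p * t by rewrite mulr_gt0.
  apply: (no_positive_solution N0 (s0 := (p + 1) / (p * t)) p0 t0 LE).
  - by rewrite divr_gt0.
  - by rewrite (le_trans (_ : _ <= 0)) ?subr_le0// divr_ge0// ltW.
  - rewrite mulrA ltr_pdivrMr// mulrC.
    have : 0 < (p + 1) * (p * t) by rewrite mulr_gt0.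
    lra.
have n3 : 3 <= N%:R :> R by rewrite ler_nat.
have [H|H] := ltP ((p * t - 1) * (N%:R - 2)) (2 * p + 2).
  by apply: (no_positive_solution N0 (s0 := N%:R - 2) p0 t0 LE) => //; lra.
have pt : 0 < p * t - 1.
  by rewrite -(pmulr_lgt0 _ (_ : 0 < N%:R - 2)); lra.
have cmp := scaling_comparison t0 tp (_ : 1 < p * t) LE.
have {}cmp := cmp (ltac:(lra)).
(* The exponents under which dilation preserves the system; subcriticality reads [N < a + b + 2]. *)
pose a := 2 * (p + 1) / (p * t - 1); pose b := 2 * (t + 1) / (p * t - 1).
have bp : b * p = a + 2 by rewrite /a /b; field; rewrite gt_eqF.
have at_ : a * t = b + 2 by rewrite /a /b; field; rewrite gt_eqF.
have ab : N%:R < a + b + 2.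
  have -> : a + b + 2 = 2 * ((p + 1) * (t + 1)) / (p * t - 1).
    by rewrite /a /b; field; rewrite gt_eqF.
  by rewrite ltr_pdivlMr.
have ba : b <= a.
  by rewrite /a /b ler_pM2r ?invr_gt0//; lra.
have oU : open [set x : V | nsq x < 4] by exact: open_nsq_lt.
have sU (x : V) : nsq x <= 1 -> [set x : V | nsq x < 4] x by move=> x1 /=; lra.
have cu : continuous u by move=> x; exact: (smooth_on_C2 su).1.1.
have cv : continuous v by move=> x; exact: (smooth_on_C2 sv).1.1.
have cpow (f : V -> R) s : continuous f -> (forall x, 0 < f x) ->
    continuous (fun x => f x `^ s).
  move=> cf f0 x; apply: (@continuous_comp _ _ _ f (fun y => y `^ s)); first exact: cf.
  apply: differentiable_continuous; apply/derivable1_diffP.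
  by have [] := is_derive1_powR s (f0 x).
have ux x : 0 < u x by case: (pos x).
have vx x : 0 < v x by case: (pos x).
have scale (q : nat) : (0 < q)%N -> exists (u' v' : V -> R) du' ddu' dv' ddv' xi dxi ddxi ze dze ddze,
  [/\ LE_pair p t [set x : V | nsq x < 4] u' du' ddu' v' dv' ddv',
      LE_supersolution p t [set x : V | nsq x < 4] u' v' xi dxi ddxi ze dze ddze,
      forall x, (t + 1) * v' x `^ (p + 1) <= (p + 1) * u' x `^ (t + 1) ,
      forall x, u' x = q%:R `^ a * u (q%:R *: x) &
      forall x, v' x = q%:R `^ b * v (q%:R *: x)].
  move=> q0; have qR : 0 < q%:R :> R by rewrite ltr0n.
  have LE' := LE_pair_dilation qR bp at_ LE.
  have [xi [dxi [ddxi [ze [dze [ddze super]]]]]] := stable_supersolution qR bp at_ pos st.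
  have cmp' := scaling_comparison t0 tp (ltac:(lra) : 1 < p * t) LE'.
  do 12!eexists; split; [ |exact: super|exact: cmp'|by []|by []].
  have [h1 h2 h3 h4 h5] := LE'.
  split; [exact: C2_sub h1|exact: C2_sub h2|by move=> x _; exact: h3|..].
  - by move=> x _; exact: h4.
  - by move=> x _; exact: h5.
have [t2|t2] := leP 2 t.
- have cmp4 y z : (t + 1) * y <= (p + 1) * z -> 0 <= z -> 4 * y <= p * t * z.
    move=> yz z0; have pt4 : 4 * (p + 1) <= p * t * (t + 1) by nra.
    rewrite -(ler_pM2r t1); have := ler_wpM2r z0 pt4; lra.
  have [C C0 HC] := @second_order_bound R N p t N0 (ltac:(lra)) t2.
  (* [u v^p] scales with exponent [a + b p = 2 a + 2], above [N] since [b <= a]. *)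
  apply: (@scaling_contradiction R N (fun x => u x * v x `^ p) (2 * a + 2) C 12) => //.
  + move=> x; suff : {for x, continuous (fun x => u x * v x `^ p)} by [].
    by apply: continuousM; [exact: cu|exact: cpow].
  + by move=> x; rewrite mulr_gt0// powR_gt0.
  + by lra.
  + move=> q q0; have [u' [v' [du' [ddu' [dv' [ddv' [xi [dxi [ddxi [ze [dze [ddze]]]]]]]]]]]] := scale q q0.
    move=> [LE' super cmp' uE vE].
    have [|F nF HF] := HC _ _ _ _ _ _ _ _ _ _ _ _ _ oU sU LE' super.
      by move=> x _; apply: cmp4 => //; exact: powR_ge0.
    exists F => // x x1; apply: le_trans (HF x x1).
    rewrite uE vE powRM ?powR_ge0 ?(ltW (vx _))// -powRrM bp.
    have -> : 2 * a + 2 = a + (a + 2) by ring.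
    have qR : 0 < q%:R :> R by rewrite ltr0n.
    rewrite [q%:R `^ _]powRD; last by rewrite (gt_eqF qR) implybT.
    by rewrite le_eqVlt; apply/orP; left; apply/eqP; ring.
(* [N = 3] would give [2 p + 2 <= p t - 1], impossible for [t < 2]. With [N >= 4], subcriticality
   yields the condition [d <= 1] of [fourth_order_bound]. *)
- have n4 : 4 <= N%:R :> R.
    rewrite ler_nat ltn_neqAle N3 andbT; apply/eqP => E.
    by move: H; rewrite -E; nra.
  have t02 : 0 < t < 2 by rewrite t0.
  pose X := 2 * ((p + 1) * (t + 1)) / (p * t - 1).
  pose k := Num.trunc X.
  have d1 : 2 * (p * t - 1) <= (p + 1) * (t + 1).
    have := ler_wpM2r (ltW pt) n4; lra.
  have d2 : 4 * ((p + 1) * (t + 1)) <= 2 * (p * t - 1) * k.+4.+1%:R.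
    have -> : 4 * ((p + 1) * (t + 1)) = 2 * (p * t - 1) * X.
      by rewrite /X; field; rewrite gt_eqF.
    rewrite ler_pM2l ?mulr_gt0// (le_trans (ltW (truncnS_gt X)))//.
    by rewrite ler_nat /k -addn1 -addn4 -addn1 -addnA leq_add2l.
  have pt' : 1 < p * t by rewrite -subr_gt0.
  have [C C0 HC] := fourth_order_bound N p0 t02 pt' d1 d2.
  apply: (@scaling_contradiction R N (fun x => v x `^ (p + 1) + u x `^ (t + 1))
    (a + b + 2) C k.+4.+1) => //.
  + move=> x; suff : {for x, continuous (fun x => v x `^ (p + 1) + u x `^ (t + 1))} by [].
    by apply: continuousD; exact: cpow.
  + by move=> x; rewrite addr_gt0// powR_gt0.
  + move=> q q0; have [u' [v' [du' [ddu' [dv' [ddv' [xi [dxi [ddxi [ze [dze [ddze]]]]]]]]]]]] := scale q q0.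
    move=> [LE' super cmp' uE vE].
    have [|F nF HF] := HC _ _ _ _ _ _ _ _ _ _ _ _ _ oU sU LE' super.
      by move=> x _; exact: cmp'.
    exists F => // x x1; apply: le_trans (HF x x1).
    rewrite uE vE !powRM ?powR_ge0 ?(ltW (vx _)) ?(ltW (ux _))// -!powRrM.
    have -> : b * (p + 1) = a + b + 2 by rewrite mulrDr bp; ring.
    have -> : a * (t + 1) = a + b + 2 by rewrite mulrDr at_; ring.
    by rewrite -mulrDr.
Qed.

End Liouville.

Theorem proposition1p1 (R : realType) (N : nat) (p theta : R)
    (hN : (1 <= N)%N) (hp : 0 < p) (htheta : 0 < theta)
    (hsub : (N%:R - 2) / N%:R < 1 / (p + 1) + 1 / (theta + 1)) :
  ~ exists u v : 'rV[R]_N -> R,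
      Lane_Emden_solution p theta u v /\ stable p theta u v.
Proof.
move=> [u [v [sol st]]].
have [le|/ltW le] := leP theta p; first exact: liouville_ordered sol st.
(* Exchanging [u] with [v], [xi] with [ze] and [p] with [theta] preserves the system and
   stability. *)
apply: (liouville_ordered hN hp le _ (u := v) (v := u)).
- by rewrite [ltRHS]addrC.
- by have [su sv pos equ eqv] := sol; split=> // x; case: (pos x).
- move=> K /st [eta [xi [ze [eta0 [sxi sze] posx eqxi eqze]]]].
  by exists eta, ze, xi; split=> // x /posx[].
Qed.
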